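(* Let $m_0>0$, $\rho_1,\rho_2\ge0$ and $u_0,u_1,u_2\in\mathbb{R}$ be constants, and consider the singular Riemann problem (defined in the context) for the pressureless Euler equations $\partial_t\rho+\partial_x(\rho u)=0$, $\partial_t(\rho u)+\partial_x(\rho u^2)=0$ with initial data $$\bar\varrho=\rho_1\mathcal{L}^1\lfloor\{x<0\}+m_0\delta_0+\rho_2\mathcal{L}^1\lfloor\{x>0\},\qquad \bar u=u_1\mathsf{I}_{\{x<0\}}+u_0\mathsf{I}_{\{x=0\}}+u_2\mathsf{I}_{\{x>0\}}.$$ (Case 1) If $u_2<u_0<u_1$, the problem has a delta shock solution $$\varrho(t)=\rho_1\mathcal{L}^1\lfloor\{x<x_1(t)\}+\rho_2\mathcal{L}^1\lfloor\{x>x_1(t)\}+\alpha(t)\delta_{x_1(t)},$$ $$u(x,t)=u_1\mathsf{I}_{\{x<x_1(t)\}}+u_2\mathsf{I}_{\{x>x_1(t)\}}+x_1'(t)\mathsf{I}_{\{x=x_1(t)\}},$$ where $\alpha(t)=(\rho_2-\rho_1)x_1(t)-(\rho_2u_2-\rho_1u_1)t+m_0$ and the delta shock $x=x_1(t)$ is given by $$x_1''(t)+\frac{(\rho_1-\rho_2)x_1'(t)-2(\rho_1u_1-\rho_2u_2)}{(\rho_1-\rho_2)x_1(t)-(\rho_1u_1-\rho_2u_2)t-m_0}\,x_1'(t)+\frac{\rho_1u_1^2-\rho_2u_2^2}{(\rho_1-\rho_2)x_1(t)-(\rho_1u_1-\rho_2u_2)t-m_0}=0,$$ $x_1(0)=0$,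 $x_1'(0)=u_0$. (Case 2) If $u_0<u_1\le u_2$, the problem has a delta shock solution $$\varrho(t)=\rho_1\mathcal{L}^1\lfloor\{x<x_1(t)\}+\tilde\rho_2\,\mathcal{L}^1\lfloor\{x>x_1(t)\}+\alpha(t)\delta_{x_1(t)},$$ where $\tilde\rho_2=0$ if $x_1(t)<x<u_2t$ and $\tilde\rho_2=\rho_2$ if $x\ge u_2t$, with velocity $u=u_1$ for $x<x_1(t)$, $u=x_1'(t)$ at $x=x_1(t)$, $u=u_2$ for $x\ge u_2t$, and $u$ not defined for $x_1(t)<x<u_2t$, where $\alpha(t)=-\rho_1x_1(t)+\rho_1u_1t+m_0$ and the delta shock $x=x_1(t)$ is given by $$x_1''(t)+\frac{\rho_1x_1'(t)-2\rho_1u_1}{\rho_1x_1(t)-\rho_1u_1t-m_0}\,x_1'(t)+\frac{\rho_1u_1^2}{\rho_1x_1(t)-\rho_1u_1t-m_0}=0,$$ $x_1(0)=0$, $x_1'(0)=u_0$.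
   Context: Notation: $\mathcal{L}^1$ is Lebesgue measure on $\mathbb{R}$; $\mu\lfloor A$ is the restriction of a measure $\mu$ to $A$; $\delta_a$ is the Dirac measure at $a$; $\mathsf{I}_A$ is the indicator function of $A$. $\mathscr{M}(\mathbb{R})$ is the space of Radon measures on $\mathbb{R}$ (dual of $C_c(\mathbb{R})$) with the weak* topology, $\langle\cdot,\cdot\rangle$ is the pairing of a measure with a test function, and $C([0,+\infty);\mathscr{M}(\mathbb{R}))$ is the space of weak*-continuous maps. Measure solution of the singular Riemann problem: let $\varrho,m,n\in C([0,+\infty);\mathscr{M}(\mathbb{R}))$ with $\varrho(t)$ nonnegative for all $t\ge0$. The pair $(\varrho,u)$ is a (Radon) measure solution with initial data $(\bar\varrho,\bar u)$ if (i) for every $\phi\in C_c^1(\mathbb{R}^2)$, $$\int_0^{+\infty}\langle\varrho(t),\phi_t(\cdot,t)\rangle\,dt+\int_0^{+\infty}\langle m(t),\phi_x(\cdot,t)\rangle\,dt+\langle\varrho(0),\phi(\cdot,0)\rangle=0,$$ $$\int_0^{+\infty}\langle m(t),\phi_t(\cdot,t)\rangle\,dt+\int_0^{+\infty}\langle n(t),\phi_x(\cdot,t)\rangle\,dt+\langle m(0),\phi(\cdot,0)\rangle=0,$$ where $\varrho(0)=\bar\varrho$ and $m(0)=\bar u\bar\varrho=\rho_1u_1\mathcal{L}^1\lfloor\{x<0\}+m_0u_0\delta_0+\rho_2u_2\mathcal{L}^1\lfloor\{x>0\}$; (ii) for all $t\ge0$, $m(t)$ and $n(t)$ are absolutely continuous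 with respect to $\varrho(t)$, with Radon-Nikodym derivatives $\frac{dm(t)}{d\varrho(t)}(x)=u(x,t)$ and $\frac{dn(t)}{d\varrho(t)}(x)=u(x,t)^2$. (Thus $u$ has no meaning on open $\varrho$-null sets, i.e. in the vacuum.) A delta shock solution is a measure solution of the form $\varrho(t)=\tilde\rho_1\mathcal{L}^1\lfloor\{x<x(t)\}+\tilde\rho_2\mathcal{L}^1\lfloor\{x>x(t)\}+\alpha(t)\delta_{x(t)}$, with $u=\tilde u_1$ for $x<x(t)$, $u=\tilde u_2$ for $x>x(t)$, $u=x'(t)$ at $x=x(t)$, where $x(\cdot)$ is a Lipschitz function of $t\ge0$ (its graph is called the delta shock), $\alpha$ is a nontrivial nonnegative function, and $\tilde\rho_i\ge0$; in Case 2 the right state $(\tilde\rho_2,\tilde u_2)$ is allowed to be piecewise constant, as specified in the claim. *)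

(* Defs.v *)
From HB Require Import structures.
From mathcomp Require Import all_boot all_order all_algebra.
From mathcomp Require Import all_classical all_reals all_analysis.

Set Implicit Arguments.
Unset Strict Implicit.
Unset Printing Implicit Defensive.

Import Order.TTheory GRing.Theory Num.Theory numFieldNormedType.Exports.

Local Open Scope classical_set_scope.
Local Open Scope ring_scope.

(* A locally finite Borel measure on the line is automatically regular. *)
Record radon_measure (R : realType) := RadonMeasure {
  radon_val :> {measure set (measurableTypeR R) -> \bar R};
  radon_compact : forall K : set R, compact K -> (radon_val K < +oo)%E }.

(* The elements of M(R), the dual of C_c(R), are the real-valued Radon
   measures; their total variation may be infinite, so they are not charges on
   the whole line.  An element is encoded by its Jordan decomposition, which
   determines and is determined by it. *)
Record signed_radon (R : realType) := SignedRadon {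
  spos : radon_measure R;
  sneg : radon_measure R;
  spos_sneg_singular : exists A : set (measurableTypeR R),
    [/\ measurable A, spos A = 0%E & sneg (~` A) = 0%E] }.

Section radon_measures.
Context {R : realType}.

Definition mzero_radon : radon_measure R :=
  @RadonMeasure R (@mzero _ (measurableTypeR R) R) (fun _ _ => ltry 0).

Lemma radon_mzero_singular (mu : radon_measure R) :
  exists A : set (measurableTypeR R),
    [/\ measurable A, mu A = 0%E & mzero_radon (~` A) = 0%E].
Proof. by exists set0; split => //; exact: measure0. Qed.

Definition signed_of_radon (mu : radon_measure R) : signed_radon R :=
  SignedRadon (radon_mzero_singular mu).

Definition pairing (nu : signed_radon R) (f : R -> R) : R :=
  \int[spos nu]_x f x - \int[sneg nu]_x f x.

Definition compact_supp (T : topologicalType) (f : T -> R) : Prop :=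
  compact (closure [set z | f z != 0]).

Definition Cc (f : R -> R) : Prop := continuous f /\ compact_supp f.

(* nu belongs to C([0,+oo); M(R)), M(R) with the weak* topology; the values at
   negative times are irrelevant. *)
Definition weakly_continuous (nu : R -> signed_radon R) : Prop :=
  forall f : R -> R, Cc f ->
    {within [set t : R | 0 <= t], continuous (fun t => pairing (nu t) f)}.

Definition abs_continuous (nu : signed_radon R) (mu : radon_measure R) : Prop :=
  spos nu `<< mu /\ sneg nu `<< mu.

(* nu = g mu as signed Radon measures: they agree on bounded Borel sets, the
   only ones where a signed Radon measure always has a value. *)
Definition has_density (nu : signed_radon R) (mu : radon_measure R)
    (g : R -> R) : Prop :=
  forall A : set (measurableTypeR R), measurable A -> bounded_set (A : set R) ->
    mu.-integrable A (EFin \o g) /\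
    (spos nu A - sneg nu A = \int[mu]_(x in A) (g x)%:E)%E.

(* f is only partially defined (None = no value); as a Radon-Nikodym
   derivative it has to be defined mu-almost everywhere. *)
Definition RN_derivative (nu : signed_radon R) (mu : radon_measure R)
    (f : R -> option R) : Prop :=
  abs_continuous nu mu /\
  exists g : R -> R, has_density nu mu g /\ {ae mu, forall x, f x = Some (g x)}.

End radon_measures.

Section measure_solutions.
Context {R : realType}.

(* Functions of the plane take the pair (x, t). *)
Definition dx (phi : R * R -> R) (x t : R) : R := derive1 (fun y => phi (y, t)) x.
Definition dt (phi : R * R -> R) (x t : R) : R := derive1 (fun s => phi (x, s)) t.

Definition test_function (phi : R * R -> R) : Prop :=
  [/\ forall x t, derivable (fun y => phi (y, t)) x 1,
      forall x t, derivable (fun s => phi (x, s)) t 1,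
      continuous (fun z : R * R => dx phi z.1 z.2),
      continuous (fun z : R * R => dt phi z.1 z.2) &
      compact_supp phi].

Local Notation leb := (@lebesgue_measure R).

Definition balance_law (p q : R -> signed_radon R) : Prop :=
  forall phi, test_function phi ->
    \int[leb]_(t in [set t : R | 0 <= t]) pairing (p t) (fun x => dt phi x t) +
    \int[leb]_(t in [set t : R | 0 <= t]) pairing (q t) (fun x => dx phi x t) +
    pairing (p 0) (fun x => phi (x, 0)) = 0.

(* The velocity u x t is a partial function: it has no meaning in the vacuum. *)
Definition measure_solution (rhobar : set R -> \bar R) (ubar : R -> R)
    (rho : R -> radon_measure R) (u : R -> R -> option R) : Prop :=
  exists m n : R -> signed_radon R,
  [/\ [/\ weakly_continuous (fun t => signed_of_radon (rho t)),
          weakly_continuous m & weakly_continuous n],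
      balance_law (fun t => signed_of_radon (rho t)) m /\ balance_law m n,
      (forall A : set (measurableTypeR R), measurable A -> rho 0 A = rhobar A),
      has_density (m 0) (rho 0) ubar &
      forall t, 0 <= t ->
        RN_derivative (m t) (rho t) (u^~ t) /\
        RN_derivative (n t) (rho t) (fun x => omap (fun v => v ^+ 2) (u x t))].

Definition riemann_rho (rho1 m0 rho2 : R) (A : set R) : \bar R :=
  (rho1%:E * leb (A `&` [set x | (x < 0)%R]) + m0%:E * \d_(0%R : R) A
   + rho2%:E * leb (A `&` [set x | (0 < x)%R]))%E.

Definition riemann_u (u1 u0 u2 x : R) : R :=
  u1 * \1_[set y : R | y < 0] x + u0 * \1_[set y : R | y = 0] x
  + u2 * \1_[set y : R | 0 < y] x.

End measure_solutions.

Section delta_shocks.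
Context {R : realType}.

Local Notation leb := (@lebesgue_measure R).

(* Derivatives of functions of t >= 0: one-sided at t = 0. *)
Definition half_quotient (x : R -> R) (t s : R) : R := (x s - x t) / (s - t).

Definition half_filter (t : R) := within [set s : R | 0 <= s] t^'.

Definition half_derivable (x : R -> R) (t : R) : Prop :=
  cvg (half_quotient x t @ half_filter t).

Definition half_derive (x : R -> R) (t : R) : R :=
  lim (half_quotient x t @ half_filter t).

Definition shock_density (r1 : R) (r2 : R -> R -> R) (x alpha : R -> R) (t : R)
    (A : set R) : \bar R :=
  (r1%:E * leb (A `&` [set y | (y < x t)%R])
   + \int[leb]_(y in A `&` [set y | (x t < y)%R]) (r2 y t)%:E
   + (alpha t)%:E * \d_(x t) A)%E.

Definition shock_velocity (v1 : R) (v2 : R -> R -> option R) (x : R -> R)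
    (y t : R) : option R :=
  if y < x t then Some v1
  else if y == x t then Some (half_derive x t)
  else v2 y t.

(* (r1, v1) is the left state, (r2, v2) the right one; the latter may depend
   on the point and on the time, and v2 may be undefined. *)
Definition delta_shock_solution (rhobar : set R -> \bar R) (ubar : R -> R)
    (r1 v1 : R) (r2 : R -> R -> R) (v2 : R -> R -> option R)
    (x alpha : R -> R) (rho : R -> radon_measure R) : Prop :=
  [/\ (exists k : R, k.-lipschitz_[set t : R | 0 <= t] x) /\
        (forall t, 0 <= t -> half_derivable x t),
      (forall t, 0 <= t -> 0 <= alpha t) /\
        (exists t, 0 <= t /\ alpha t != 0),
      0 <= r1 /\ (forall y t, 0 <= r2 y t),
      (forall t, 0 <= t -> forall A : set (measurableTypeR R), measurable A ->
        rho t A = shock_density r1 r2 x alpha t A) &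
      measure_solution rhobar ubar rho (shock_velocity v1 v2 x)].

(* The shock equation on [0,+oo), in terms of a = rho1 - rho2,
   b = rho1 u1 - rho2 u2 and c = rho1 u1^2 - rho2 u2^2; a vacuum right state
   amounts to rho2 = 0.  The denominator is required not to vanish. *)
Definition shock_ivp (a b c m0 u0 : R) (x : R -> R) : Prop :=
  [/\ forall t, 0 <= t -> half_derivable x t,
      forall t, 0 <= t -> half_derivable (half_derive x) t,
      forall t, 0 <= t -> let d := a * x t - b * t - m0 in
        d != 0 /\
        half_derive (half_derive x) t
          + (a * half_derive x t - 2 * b) / d * half_derive x t + c / d = 0,
      x 0 = 0 &
      half_derive x 0 = u0].

End delta_shocks.

(* Main.v *)
Require Import Defs.
From HB Require Import structures.
From mathcomp Require Import all_boot all_order all_algebra.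
From mathcomp Require Import all_classical all_reals all_analysis.
From mathcomp Require Import measurable_realfun ring lra.
Set Implicit Arguments.
Unset Strict Implicit.
Unset Printing Implicit Defensive.
Import Order.TTheory GRing.Theory Num.Theory numFieldNormedType.Exports.
Local Open Scope classical_set_scope.
Local Open Scope ring_scope.

(* In both cases the only unknown is the position x of the atom: mass and
   momentum balance give alpha and alpha x' as affine functions of (x, t), and
   integrating alpha x' once yields a quadratic equation for x, whose root is
   explicit.  In the frame moving with velocity u0 it reads
     y = e t^2 / (alpha + m0 + B t),  alpha^2 = m0^2 + 2 m0 B t + C t^2,
   and the form with the square root in the denominator makes sense also for
   equal densities.  The bound u2 t <= x <= u1 t gives u2 <= x' <= u1, hence
   the Lipschitz property.  Case 2 is the curve of Case 1 for an empty right
   state, followed by the contact line z = u2 t.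

   A wave c1 L|{y < x} + c2 L|{y > x, y >= z} + c3 delta_x covers rho, m and n
   in both cases (z = x in Case 1).  If p has coefficients (c1, c2, b), and q
   has coefficients (c1 v1, c2 v2, b x'), then
     <p(t), phi_t(., t)> + <q(t), phi_x(., t)>
   is the derivative of t |-> <p(t), phi(., t)> up to boundary terms, which
   vanish exactly when the jump conditions hold. *)

Lemma integral_mrestr d (T : measurableType d) (R : realType)
    (mu : {measure set T -> \bar R}) (D E : set T) (mD : measurable D)
    (mE : measurable E) (f : T -> \bar R) : measurable_fun D f ->
  (\int[mrestr mu mE]_(x in D) f x = \int[mu]_(x in D `&` E) f x)%E.
Proof.
move=> mf.
have -> : (\int[mrestr mu mE]_(x in D) f x = \int[mrestr mu mE]_(x in D `&` E) f x)%E.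
  rewrite -{1}(setUIDK D E) integral_setU.
  - rewrite [X in (_ + X)%E](_ : _ = 0%E) ?adde0//.
    apply: null_set_integral; first exact: measurableD.
      by apply: measurable_funS mf => //; apply: subDsetl.
    by apply/eqP; rewrite /= /mrestr setDE -setIA setICl setI0 measure0.
  - exact: measurableI.
  - exact: measurableD.
  - by rewrite setUIDK.
  - by apply/disj_setPS => x /= [[_ ?]] [].
apply: eq_measure_integral => A mA AD; rewrite /= /mrestr.
by rewrite setIidl// => x /AD[].
Qed.

(** * Waves *)

Section waves.
Context {R : realType}.
Local Notation leb := (@lebesgue_measure R).
Implicit Types (c v x z : R) (A : set (measurableTypeR R)).

Definition left_of x : set (measurableTypeR R) := [set y | y < x].
(** The strict bound at x keeps the atom out even when z = x; the weak bound at z is the condition x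
    >= u2 t on the right state in Case 2. *)
Definition right_of x z : set (measurableTypeR R) := [set y | x < y /\ z <= y].

Lemma measurable_left_of x : measurable (left_of x).
Proof.
rewrite (_ : left_of x = [set` `]-oo, x[%R]); first by [].
by apply/seteqP; split => y /=; rewrite in_itv.
Qed.

Lemma measurable_right_of x z : measurable (right_of x z).
Proof.
rewrite (_ : right_of x z = [set` `]x, +oo[%R] `&` [set` `[z, +oo[%R]).
  by apply: measurableI.
by apply/seteqP; split => y /=; rewrite !in_itv/= !andbT.
Qed.


Fact posc_ge0 c : 0 <= Num.max 0 c. Proof. by rewrite le_max lexx. Qed.
Definition posc c : {nonneg R} := NngNum (posc_ge0 c).

(* Negative coefficients count as 0. *)
Definition wave c1 c2 c3 x z : {measure set (measurableTypeR R) -> \bar R} :=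
  measure_add
    (measure_add (mscale (posc c1) (mrestr leb (measurable_left_of x)))
                 (mscale (posc c2) (mrestr leb (measurable_right_of x z))))
    (mscale (posc c3) (@dirac _ (measurableTypeR R) x R)).

Lemma waveE c1 c2 c3 x z A : wave c1 c2 c3 x z A =
  ((Num.max 0 c1)%:E * leb (A `&` left_of x)
   + (Num.max 0 c2)%:E * leb (A `&` right_of x z)
   + (Num.max 0 c3)%:E * \d_x A)%E.
Proof.
apply: etrans; first exact: measure_addE.
by congr (_ + _)%E; exact: measure_addE.
Qed.

Lemma ge0_integral_wave c1 c2 c3 x z A (f : measurableTypeR R -> \bar R) :
  measurable A -> measurable_fun A f -> (forall y, A y -> 0 <= f y)%E ->
  (\int[wave c1 c2 c3 x z]_(y in A) f y =
   (Num.max 0 c1)%:E * \int[leb]_(y in A `&` left_of x) f y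
   + (Num.max 0 c2)%:E * \int[leb]_(y in A `&` right_of x z) f y
   + (Num.max 0 c3)%:E * (\d_x A * f x))%E.
Proof.
move=> mA mf f0; rewrite /wave !ge0_integral_measure_add//.
rewrite !ge0_integral_mscale//=.
rewrite integral_mrestr; [|by []..].
rewrite integral_mrestr; [|by []..].
by rewrite integral_dirac.
Qed.

Lemma integrable_wave c1 c2 c3 x z A (f : measurableTypeR R -> R) :
  measurable A -> measurable_fun A f ->
  leb.-integrable (A `&` left_of x) (EFin \o f) ->
  leb.-integrable (A `&` right_of x z) (EFin \o f) ->
  (wave c1 c2 c3 x z).-integrable A (EFin \o f).
Proof.
move=> mA mf /integrableP[_ i1] /integrableP[_ i2].
have mf' : measurable_fun A (EFin \o f) by exact/measurable_EFinP.
apply/integrableP; split=> //.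
rewrite ge0_integral_wave//; last exact: measurableT_comp.
rewrite lte_add_pinfty//; last first.
  by rewrite diracE -!EFinM ltry.
by rewrite lte_add_pinfty// lte_mul_pinfty// lee_fin posc_ge0.
Qed.

(** The positive and negative parts of f are integrated by the nonnegative case. Integrability on
    the two half-lines makes the four Lebesgue terms finite, so their differences can be formed in
    R. *)
Lemma integral_wave c1 c2 c3 x z A (f : measurableTypeR R -> R) :
  measurable A -> measurable_fun A f ->
  leb.-integrable (A `&` left_of x) (EFin \o f) ->
  leb.-integrable (A `&` right_of x z) (EFin \o f) ->
  (\int[wave c1 c2 c3 x z]_(y in A) (f y)%:E =
   (Num.max 0 c1 * \int[leb]_(y in A `&` left_of x) f y
   + Num.max 0 c2 * \int[leb]_(y in A `&` right_of x z) f y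
   + Num.max 0 c3 * (\1_A x * f x))%:E)%E.
Proof.
move=> mA mf i1 i2.
have mf' : measurable_fun A (EFin \o f) by exact/measurable_EFinP.
have split_int (B : set (measurableTypeR R)) : measurable B ->
    leb.-integrable B (EFin \o f) -> exists p q : R,
    [/\ (\int[leb]_(y in B) (EFin \o f)^\+ y = p%:E)%E,
        (\int[leb]_(y in B) (EFin \o f)^\- y = q%:E)%E &
        \int[leb]_(y in B) f y = p - q].
  move=> mB iB; have fp := integrable_pos_fin_num mB iB.
  have fn := integrable_neg_fin_num mB iB.
  exists (fine (\int[leb]_(y in B) (EFin \o f)^\+ y)).
  exists (fine (\int[leb]_(y in B) (EFin \o f)^\- y)).
  rewrite !fineK//; split=> //.
  by rewrite /Rintegral integralE fineB.
have [||p1 [q1 [p1E q1E ->]]] := split_int (A `&` left_of x) => //.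
  by apply: measurableI => //; exact: measurable_left_of.
have [||p2 [q2 [p2E q2E ->]]] := split_int (A `&` right_of x z) => //.
  by apply: measurableI => //; exact: measurable_right_of.
rewrite integralE !ge0_integral_wave//; last 2 first.
- exact: measurable_funeneg.
- exact: measurable_funepos.
rewrite p1E p2E q1E q2E diracE indicE.
have -> : (EFin \o f)^\+%E x = (Num.max (f x) 0)%:E by rewrite funeposE/= EFin_max.
have -> : (EFin \o f)^\-%E x = (Num.max (- f x) 0)%:E by rewrite funenegE/= EFin_max.
rewrite -!EFinM -!EFinD; congr EFin.
have fxE : f x = Num.max (f x) 0 - Num.max (- f x) 0.
  by have [h|h] := leP (f x) 0; have [h'|h'] := leP (- f x) 0; lra.
rewrite [in RHS]fxE; ring.
Qed.
End waves.

(** * Waves as Radon measures, their Jordan decompositions and densities *)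

Section radon_waves.
Context {R : realType}.
Local Notation leb := (@lebesgue_measure R).
Implicit Types (c v x z : R) (A : set (measurableTypeR R)).

Local Hint Extern 0 (measurable (left_of _)) => exact: measurable_left_of : core.
Local Hint Extern 0 (measurable (right_of _ _)) => exact: measurable_right_of : core.

Lemma bounded_lebesgue_lty A : measurable A -> bounded_set (A : set R) ->
  (leb A < +oo)%E.
Proof.
move=> mA [N [_ N1x]].
have AN1 : A `<=` `[- (`|N| + 1), `|N| + 1].
  by move=> y Ay; rewrite set_itvcc /= -ler_norml N1x// ltr_pwDr// ler_norm.
rewrite (le_lt_trans (le_measure _ _ _ AN1)) ?inE//=.
by rewrite lebesgue_measure_itv/= lte_fin gtrN// EFinD ltry.
Qed.

Lemma bounded_setI_lebesgue_lty A (B : set (measurableTypeR R)) :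
  measurable A -> measurable B -> bounded_set (A : set R) ->
  (leb (A `&` B) < +oo)%E.
Proof.
move=> mA mB bA; apply: le_lt_trans (bounded_lebesgue_lty mA bA).
apply: le_measure; rewrite ?inE; [exact: measurableI|by []|].
exact: subIsetl.
Qed.

Lemma wave_compact c1 c2 c3 x z (K : set R) : compact K ->
  (wave c1 c2 c3 x z K < +oo)%E.
Proof.
move=> cK; have mK := compact_measurable cK; have bK := compact_bounded cK.
rewrite waveE diracE -EFinM.
rewrite lte_add_pinfty ?ltry// lte_add_pinfty// lte_mul_pinfty// ?lee_fin ?posc_ge0//.
  exact: bounded_setI_lebesgue_lty.
exact: bounded_setI_lebesgue_lty.
Qed.

Definition radon_wave c1 c2 c3 x z : radon_measure R :=
  @RadonMeasure R (wave c1 c2 c3 x z) (@wave_compact c1 c2 c3 x z).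

Lemma wave_eq0 c1 c2 c3 x z A :
  c1 <= 0 \/ A `&` left_of x = set0 -> c2 <= 0 \/ A `&` right_of x z = set0 ->
  c3 <= 0 \/ ~ A x -> wave c1 c2 c3 x z A = 0%E.
Proof.
move=> h1 h2 h3; rewrite waveE.
have -> : ((Num.max 0 c1)%:E * leb (A `&` left_of x) = 0)%E.
  by case: h1 => [c0|->]; [rewrite max_l ?mul0e|rewrite measure0 mule0].
have -> : ((Num.max 0 c2)%:E * leb (A `&` right_of x z) = 0)%E.
  by case: h2 => [c0|->]; [rewrite max_l ?mul0e|rewrite measure0 mule0].
rewrite !add0e diracE.
by case: h3 => [c0|Ax]; [rewrite max_l ?mul0e|rewrite memNset ?mule0].
Qed.

(* The positive and the negative parts of the coefficients (c1, c2, c3) define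
   the Jordan decomposition of a signed wave. *)
Lemma wave_opp_singular c1 c2 c3 x z : exists A,
  [/\ measurable A, radon_wave c1 c2 c3 x z A = 0%E &
      radon_wave (- c1) (- c2) (- c3) x z (~` A) = 0%E].
Proof.
(* P collects the pieces with a positive coefficient. The wave vanishes off P, and the opposite wave
   vanishes on P because the three pieces are pairwise disjoint. *)
pose P : set (measurableTypeR R) := (if c1 <= 0 then set0 else left_of x) `|`
   ((if c2 <= 0 then set0 else right_of x z) `|` (if c3 <= 0 then set0 else [set x])).
exists (~` P); split.
- apply: measurableC; apply: measurableU; first by case: ifP.
  apply: measurableU; first by case: ifP.
  by case: ifP => // _; exact: measurable_set1.
- apply: wave_eq0.
  + have [c0|c0] := leP c1 0; [by left|right].
    rewrite -subset0 => y [nP yl]; apply: nP; left.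
    by rewrite leNgt c0.
  + have [c0|c0] := leP c2 0; [by left|right].
    rewrite -subset0 => y [nP yl]; apply: nP; right; left.
    by rewrite leNgt c0.
  + have [c0|c0] := leP c3 0; [by left|right].
    by apply; right; right; rewrite leNgt c0.
- rewrite setCK; apply: wave_eq0; rewrite oppr_le0 leNgt.
  + have [c0|c0] := leP 0 c1; first by left.
    right; rewrite -subset0 => y [+ yl]; rewrite /P (ltW c0).
    move=> [//|[]]; case: ifP => // _; rewrite /left_of /right_of/= in yl *.
      by move=> [/lt_trans/(_ yl)]; rewrite ltxx.
    by move=> yx; rewrite yx ltxx in yl.
  + have [c0|c0] := leP 0 c2; first by left.
    right; rewrite -subset0 => y [+ [yl _]]; rewrite /P (ltW c0).
    move=> [|[//|]].
      by case: ifP => // _ /lt_trans/(_ yl); rewrite ltxx.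
    by case: ifP => // _ /= yx; rewrite yx ltxx in yl.
  + have [c0|c0] := leP 0 c3; first by left.
    right; rewrite /P (ltW c0).
    move=> [|[|//]].
      by case: ifP => // _; rewrite /left_of/= ltxx.
    by case: ifP => // _ []; rewrite /= ltxx.
Qed.

Definition signed_wave c1 c2 c3 x z : signed_radon R :=
  SignedRadon (wave_opp_singular c1 c2 c3 x z).

(** A density has to be total: between x and z, where the wave has no mass, v2 serves as a harmless
    value. *)
Definition wave_velocity v1 v2 v3 x (y : R) : R :=
  if y < x then v1 else if y == x then v3 else v2.

Lemma max0BN c : Num.max 0 c - Num.max 0 (- c) = c.
Proof. by have [h|h] := leP 0 c; have [h'|h'] := leP 0 (- c); lra. Qed.

(** The velocity is constant on each of the three pieces, and a bounded set has finite measure, so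
    both sides reduce to finite sums of coefficient times velocity times measure. *)
Lemma wave_density c1 c2 c3 v1 v2 v3 x z : 0 <= c1 -> 0 <= c2 -> 0 <= c3 ->
  has_density (signed_wave (c1 * v1) (c2 * v2) (c3 * v3) x z)
    (radon_wave c1 c2 c3 x z) (wave_velocity v1 v2 v3 x).
Proof.
move=> c10 c20 c30 A mA bA.
set g := wave_velocity _ _ _ _.
have mg : measurable_fun (setT : set (measurableTypeR R)) (g : measurableTypeR R -> R).
  apply: measurable_fun_ifT => //; first exact: measurable_fun_ltr.
  apply: measurable_fun_ifT => //.
  exact: measurable_fun_eqr.
have mgA : measurable_fun A (g : measurableTypeR R -> R) by exact: measurable_funTS.
have intg B : measurable B -> (leb B < +oo)%E -> leb.-integrable B (EFin \o g).
  move=> mB fB; apply: measurable_bounded_integrable => //.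
    exact: measurable_funTS.
  exists (`|v1| + `|v2| + `|v3|); split => // M MM y _ /=.
  rewrite (le_trans _ (ltW MM))// /g /wave_velocity.
  have := (normr_ge0 v1, normr_ge0 v2, normr_ge0 v3).
  move=> [[]]; case: ifP => _; [lra|case: ifP => _; lra].
have l1 := @bounded_setI_lebesgue_lty A _ mA (measurable_left_of x) bA.
have l2 := @bounded_setI_lebesgue_lty A _ mA (measurable_right_of x z) bA.
have i1 : leb.-integrable (A `&` left_of x) (EFin \o g).
  by apply: intg => //; exact: measurableI.
have i2 : leb.-integrable (A `&` right_of x z) (EFin \o g).
  by apply: intg => //; exact: measurableI.
split; first exact: integrable_wave.
rewrite [RHS]integral_wave//= !waveE.
have -> : \int[leb]_(y in A `&` left_of x) g y = v1 * fine (leb (A `&` left_of x)).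
  rewrite -Rintegral_cst; last exact: measurableI.
  apply: eq_Rintegral => y; rewrite inE => -[_ yl].
  by rewrite /g /wave_velocity yl.
have -> : \int[leb]_(y in A `&` right_of x z) g y = v2 * fine (leb (A `&` right_of x z)).
  rewrite -Rintegral_cst; last exact: measurableI.
  apply: eq_Rintegral => y; rewrite inE => -[_ [yl _]].
  by rewrite /g /wave_velocity ltNge (ltW yl)/= gt_eqF.
have -> : g x = v3 by rewrite /g /wave_velocity ltxx eqxx.
rewrite -(@fineK _ (leb (A `&` left_of x))) ?ge0_fin_numE//.
rewrite -(@fineK _ (leb (A `&` right_of x z))) ?ge0_fin_numE//.
rewrite diracE indicE -!EFinM -!EFinD /=; congr EFin.
rewrite (max_r c10) (max_r c20) (max_r c30).
(* The positive part of each product is eliminated in favour of the product and its negative part,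
   after which the identity is polynomial. *)
have e c : Num.max 0 c = c + Num.max 0 (- c).
  by rewrite -[X in X + _]max0BN subrK.
by rewrite (e (c1 * v1)) (e (c2 * v2)) (e (c3 * v3)); ring.
Qed.

(** On a null set each of the three nonnegative terms vanishes, through its coefficient or through
    its measure; either cause persists when the coefficient is multiplied by a velocity. *)
Lemma wave_abs_continuous c1 c2 c3 v1 v2 v3 x z :
  0 <= c1 -> 0 <= c2 -> 0 <= c3 ->
  abs_continuous (signed_wave (c1 * v1) (c2 * v2) (c3 * v3) x z)
    (radon_wave c1 c2 c3 x z).
Proof.
move=> c10 c20 c30.
have dom w1 w2 w3 : wave (c1 * w1) (c2 * w2) (c3 * w3) x z `<< wave c1 c2 c3 x z.
  apply/null_content_dominatesP => A mA.
  rewrite [X in X = _](waveE c1 c2 c3 x z A) waveE (max_r c10) (max_r c20) (max_r c30) => /eqP.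
  rewrite !padde_eq0 ?adde_ge0 ?mule_ge0//.
  have key c v (m : \bar R) : (c%:E * m = 0 -> (Num.max 0 (c * v)%R)%:E * m = 0)%E.
    by move/eqP; rewrite mule_eq0 => /orP[/eqP[->]|/eqP->];
      rewrite ?mul0r ?maxxx ?mul0e ?mule0.
  move=> /andP[/andP[/eqP/key-> /eqP/key->] /eqP/key->].
  by rewrite !adde0.
by split => /=; rewrite -?mulrN; exact: dom.
Qed.
End radon_waves.

(** * Pairings with compactly supported functions *)

Section primitive.
Context {R : realType}.
Local Notation leb := (@lebesgue_measure R).
Implicit Types (f g : R -> R) (L x y z : R).

Definition vanishes_outside L f := forall y, L <= `|y| -> f y = 0.

Definition primitive f x := \int[leb]_(y in `]-oo, x]) f y.

Lemma vanishes_integrable L f : continuous f -> vanishes_outside L f ->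
  leb.-integrable setT (EFin \o f).
Proof.
move=> cf f0.
have -> : EFin \o f = (EFin \o f) \_ `[- L, L].
  apply/funext => y; rewrite patchE; case: ifPn => //.
  rewrite notin_setE/= in_itv/= -ler_norml => /negP yL.
  by rewrite /= f0// ltW// ltNge.
have mI : measurable (`[- L, L]%classic : set (measurableTypeR R)) by [].
apply/integrable_restrict => //; rewrite setTI.
apply: continuous_compact_integrable; first exact: segment_compact.
exact: continuous_subspaceT.
Qed.

Lemma vanishes_integrableS L f (D : set (measurableTypeR R)) : measurable D ->
  continuous f -> vanishes_outside L f -> leb.-integrable D (EFin \o f).
Proof.
by move=> mD cf f0; apply: integrableS (vanishes_integrable cf f0).
Qed.

Lemma is_derive_primitive L f x : continuous f -> vanishes_outside L f ->
  is_derive x 1 (primitive f) (f x).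
Proof.
move=> cf f0.
(* The end point x + 1 only serves to make x interior to the interval of integration. *)
have [||||d dE] := @continuous_FTC1 R f -oo%O x (x + 1).
- by rewrite ltrDl.
- exact: (vanishes_integrableS _ cf f0).
- by rewrite ltNyr.
- exact: cf.
by rewrite -dE; apply: DeriveDef => //; rewrite derive1E.
Qed.

Lemma primitive_eq0 L f x : vanishes_outside L f -> x <= - L -> primitive f x = 0.
Proof.
move=> f0 xL; rewrite /primitive (@eq_Rintegral _ _ _ _ _ (cst 0)).
  by rewrite Rintegral_cst// mul0r.
move=> y; rewrite inE/= in_itv/= => yx; apply: f0.
by rewrite ler_normr; apply/orP; right; rewrite lerNr (le_trans yx).
Qed.

(** The difference [primitive f - g] has derivative zero and vanishes far to the left, hence
    everywhere. *)
Lemma primitive_derive L f g x : continuous f -> vanishes_outside L f ->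
  (forall y, is_derive y 1 g (f y)) -> vanishes_outside L g ->
  primitive f x = g x.
Proof.
move=> cf f0 gf g0.
have d0 y : is_derive y (1 : R) (primitive f - g) 0.
  rewrite -(subrr (f y)); apply: is_deriveB.
  exact: is_derive_primitive cf f0.
have p0 : primitive f (- `|L|) = 0.
  by apply: (primitive_eq0 f0); rewrite lerN2 ler_norm.
have gL0 : g (- `|L|) = 0 by rewrite g0// normrN normr_id ler_norm.
have : primitive f x - g x = primitive f (- `|L|) - g (- `|L|).
  exact: (is_derive_0_is_cst x (- `|L|) d0).
by rewrite p0 gL0 subrr => /eqP; rewrite subr_eq0 => /eqP.
Qed.

(** Since f vanishes beyond L, [primitive f L] is the integral over the whole line; hence z may lie
    on either side of L. *)
Lemma Rintegral_right L f z : continuous f -> vanishes_outside L f ->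
  \int[leb]_(y in `]z, +oo[) f y = primitive f L - primitive f z.
Proof.
move=> cf f0.
have right y : \int[leb]_y f y - primitive f y = \int[leb]_(y in `]y, +oo[) f y.
  rewrite -set_itvNyy Rintegral_itvB//.
  exact: (vanishes_integrableS _ cf f0).
have tail0 : \int[leb]_(y in `]L, +oo[) f y = 0.
  rewrite (@eq_Rintegral _ _ _ _ _ (cst 0)) ?Rintegral_cst ?mul0r// => y.
  rewrite inE/= in_itv/= andbT => yL; apply: f0.
  by rewrite (le_trans (ltW yL))// ler_norm.
by rewrite -right -(subrKC (primitive f L) (\int[leb]_y f y)) right tail0 addr0.
Qed.

Lemma Rintegral_left_of L f x : continuous f -> vanishes_outside L f ->
  \int[leb]_(y in left_of x) f y = primitive f x.
Proof.
move=> cf f0.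
have -> : left_of x = [set` `]-oo, x[%R].
  by apply/seteqP; split => y /=; rewrite in_itv.
rewrite Rintegral_itv_bndo_bndc//.
exact: (vanishes_integrableS _ cf f0).
Qed.

(** The region is the open half-line at z when x = z and the closed one when x < z; the end point is
    Lebesgue null. *)
Lemma Rintegral_right_of L f x z : continuous f -> vanishes_outside L f -> x <= z ->
  \int[leb]_(y in right_of x z) f y = primitive f L - primitive f z.
Proof.
move=> cf f0; rewrite le_eqVlt => /predU1P[->|xz].
  have -> : right_of z z = [set` `]z, +oo[%R].
    apply/seteqP; split => y /=; rewrite in_itv/= andbT; first by case.
    by move=> zy; split => //; exact: ltW.
  exact: Rintegral_right.
have -> : right_of x z = [set` `[z, +oo[%R].
  apply/seteqP; split => y /=; rewrite in_itv/= andbT; first by case.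
  by move=> zy; split => //; exact: lt_le_trans zy.
rewrite -Rintegral_itv_obnd_cbnd; first exact: Rintegral_right.
exact: (vanishes_integrableS _ cf f0).
Qed.

(** The pairing in closed form for f vanishing outside L. Being explicit in x, z and the weight of
    the atom, it can be differentiated in time. *)
Definition wave_pairing c1 c2 c3 x z L f : R :=
  c1 * primitive f x + c2 * (primitive f L - primitive f z) + c3 * f x.

Lemma Rintegral_wave c1 c2 c3 x z L f : x <= z ->
  continuous f -> vanishes_outside L f ->
  \int[wave c1 c2 c3 x z]_y f y =
  wave_pairing (Num.max 0 c1) (Num.max 0 c2) (Num.max 0 c3) x z L f.
Proof.
move=> xz cf f0; rewrite /Rintegral integral_wave//=.
- rewrite !setTI (Rintegral_left_of _ cf f0) (Rintegral_right_of cf f0)//.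
  by rewrite indicT mul1r.
- by apply: continuous_measurable_fun.
- rewrite setTI; apply: (vanishes_integrableS _ cf f0).
  exact: measurable_left_of.
- rewrite setTI; apply: (vanishes_integrableS _ cf f0).
  exact: measurable_right_of.
Qed.

Lemma pairing_signed_wave c1 c2 c3 x z L f : x <= z ->
  continuous f -> vanishes_outside L f ->
  pairing (signed_wave c1 c2 c3 x z) f = wave_pairing c1 c2 c3 x z L f.
Proof.
move=> xz cf f0; rewrite /pairing/= !(Rintegral_wave _ _ _ xz cf f0).
have e (c : R) : Num.max 0 c = c + Num.max 0 (- c).
  by rewrite -[X in X + _]max0BN subrK.
by rewrite /wave_pairing (e c1) (e c2) (e c3); ring.
Qed.

Lemma pairing_radon_wave c1 c2 c3 x z L f : 0 <= c1 -> 0 <= c2 -> 0 <= c3 ->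
  x <= z -> continuous f -> vanishes_outside L f ->
  pairing (signed_of_radon (radon_wave c1 c2 c3 x z)) f =
  wave_pairing c1 c2 c3 x z L f.
Proof.
move=> c10 c20 c30 xz cf f0; rewrite /pairing/= (Rintegral_wave _ _ _ xz cf f0).
by rewrite /Rintegral integral_measure_zero subr0 !max_r.
Qed.
End primitive.

(** * Continuity and chain rule along a moving point *)

Section curves.
Context {R : realType}.

(* Lipschitz continuity in the first variable, uniformly in the second, turns
   separate continuity into joint continuity. *)
Lemma continuous_along (T : topologicalType) (p : T) (F : R -> R -> R) K (x s : T -> R) :
  (forall a b t, `|F a t - F b t| <= K * `|a - b|) ->
  {for p, continuous x} -> {for p, continuous s} ->
  {for s p, continuous (F (x p))} ->
  {for p, continuous (fun q => F (x q) (s q))}.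
Proof.
move=> FK cx cs cF.
have cFs : F (x p) (s q) @[q --> p] --> F (x p) (s p).
  exact: (@continuous_comp _ _ _ s (F (x p)) p cs cF).
have d0 : F (x q) (s q) - F (x p) (s q) @[q --> p] --> 0.
  apply: norm_cvg0.
  apply: (@squeeze_cvgr _ _ _ _ (cst 0) (fun q => K * `|x q - x p|)).
  - by near=> q; rewrite normr_ge0 FK.
  - exact: cvg_cst.
  - have cxp : (fun q => x q - x p) @ p --> x p - x p.
      by apply: cvgB; [exact: cx|exact: cvg_cst].
    rewrite (_ : (0 : R) = K * `|x p - x p|); last by rewrite subrr normr0 mulr0.
    exact: (cvgM (cvg_cst K) (cvg_norm cxp)).
rewrite /prop_for /continuous_at -[X in _ --> X]add0r.
rewrite (_ : (fun q => _) = fun q => (F (x q) (s q) - F (x p) (s q)) + F (x p) (s q)).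
  exact: cvgD d0 cFs.
by apply/funext => q; rewrite subrK.
Unshelve. all: by end_near. Qed.

Lemma is_derive_cvgP (f : R -> R) (t l : R) :
  is_derive t (1 : R) f l <-> h^-1 * (f (h + t) - f t) @[h --> 0^'] --> l.
Proof.
have E : (fun h : R => h^-1 *: (f (h *: (1 : R) + t) - f t)) =
    (fun h => h^-1 * (f (h + t) - f t)).
  by apply/funext => h; rewrite /GRing.scale/= mulr1.
split=> [[df <-]|fl].
  by rewrite -E; exact: df.
have fl' : (fun h : R => h^-1 *: (f (h *: (1 : R) + t) - f t)) @ 0^' --> l by rewrite E.
apply: DeriveDef; first by apply/cvg_ex; exists l.
by rewrite /derive; apply: cvg_lim fl'.
Qed.

(** The points a and b come in either order, so the intermediate point is located by its distance to
    a. *)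
Lemma mean_value (f df : R -> R) (a b : R) :
  (forall y, is_derive y (1 : R) f (df y)) ->
  exists2 c, `|c - a| <= `|b - a| & f b - f a = df c * (b - a).
Proof.
move=> fdf.
have cf (u v : R) : {within `[u, v], continuous f}.
  apply: continuous_subspaceT => y.
  by apply/differentiable_continuous/derivable1_diffP; case: (fdf y).
have [ab|/ltW ba] := leP a b.
  have [c] := MVT_segment ab (fun y _ => fdf y) (cf _ _).
  rewrite in_itv/= => /andP[ac cb] fE; exists c => //.
  by rewrite !ger0_norm ?subr_ge0// lerD2r.
have [c] := MVT_segment ba (fun y _ => fdf y) (cf _ _).
rewrite in_itv/= => /andP[bc ca] fE; exists c.
  by rewrite !ler0_norm ?subr_le0// lerN2 lerD2r.
by rewrite -opprB fE -mulrN opprB.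
Qed.

(** The increment is split at (x t, h + t). The part in the first variable is controlled by the mean
    value theorem and the continuity of D at (x t, t); the other part needs only the time derivative
    at the fixed point x t. *)
Lemma is_derive_along (F D : R -> R -> R) (x : R -> R) (t dx d : R) :
  (forall a s, is_derive a (1 : R) (F ^~ s) (D a s)) ->
  {for (x t, t), continuous (fun p : R * R => D p.1 p.2)} ->
  is_derive t (1 : R) x dx -> is_derive t (1 : R) (F (x t)) d ->
  is_derive t (1 : R) (fun s => F (x s) s) (D (x t) t * dx + d).
Proof.
move=> FD cD xdx Fd.
(* The slope of F along x, extended by D where x (h + t) = x t. *)
pose S h := if x (h + t) == x t then D (x t) t else
  (F (x (h + t)) (h + t) - F (x t) (h + t)) / (x (h + t) - x t).
have SE h : F (x (h + t)) (h + t) - F (x t) (h + t) = S h * (x (h + t) - x t).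
  rewrite /S; case: eqVneq => [->|ne]; first by rewrite !subrr mulr0.
  by rewrite divfK// subr_eq0.
have cx : {for t, continuous x}.
  by apply/differentiable_continuous/derivable1_diffP; case: xdx.
have cS : S h @[h --> 0^'] --> D (x t) t.
  apply/cvgrPdist_le => e e0.
  have /cvgrPdist_le/(_ _ e0) := cD.
  move=> [[A B]/= [/nbhs_ballP[r1/= r10 A1] /nbhs_ballP[r2/= r20 B2]] AB].
  have /cvgrPdist_lt/(_ _ r10) := cx.
  move=> /nbhs_ballP[r3/= r30 X3].
  near=> h.
  have h2 : `|h| < r2 by near: h; apply: dnbhs0_lt.
  have h3 : `|h| < r3 by near: h; apply: dnbhs0_lt.
  have xh : `|x t - x (h + t)| < r1.
    by apply: X3; rewrite /ball/= opprD addrCA subrr addr0 normrN.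
  rewrite /S; case: eqVneq => [_|ne]; first by rewrite subrr normr0 ltW.
  have [c cx1 ->] := mean_value (x t) (x (h + t)) (fun y => FD y (h + t)).
  rewrite mulfK ?subr_eq0//.
  apply: (AB (c, h + t)); split => /=.
    apply: A1; rewrite /ball/= distrC (le_lt_trans cx1)// distrC//.
  by apply: B2; rewrite /ball/= opprD addrCA subrr addr0 normrN.
apply/is_derive_cvgP.
rewrite (_ : (fun h => _) = fun h => S h * (h^-1 * (x (h + t) - x t)) +
    h^-1 * (F (x t) (h + t) - F (x t) t)).
  by apply: cvgD; [apply: cvgM => //|]; exact/is_derive_cvgP.
by apply/funext => h; rewrite mulrCA -SE -mulrDr subrKA.
Unshelve. all: by end_near. Qed.
End curves.

(** * Primitives depending on time: continuity and differentiation under the integral *)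

Section parameters.
Context {R : realType}.
Local Notation leb := (@lebesgue_measure R).
Variables (L K : R) (psi : R -> R -> R).
Hypothesis psi_cont : forall t, continuous (psi ^~ t).
Hypothesis psi_vanish : forall t, vanishes_outside L (psi ^~ t).
Hypothesis psi_bound : forall y t, `|psi y t| <= K.

(** An integrable majorant uniform in time, so that dominated convergence applies on any time window
    around t. *)
Let dom y := K * \1_(`[- L, L]%classic : set R) y.

Let psi_dom y t : `|psi y t| <= dom y.
Proof.
rewrite /dom indicE; case: (boolP (_ \in _)); first by rewrite mulr1.
rewrite notin_setE/= in_itv/= -ler_norml => /negP yL.
by rewrite mulr0 psi_vanish ?normr0// ltW// ltNge.
Qed.

Let dom_integrable (D : set (measurableTypeR R)) : measurable D ->
  leb.-integrable D (EFin \o dom).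
Proof.
move=> mD; apply: (@integrableS _ _ _ leb setT) => //.
rewrite (_ : EFin \o dom = fun y => (K%:E * (\1_(`[- L, L]%classic : set R) y)%:E)%E).
  apply: integrableZl => //; apply: integrable_indic_itv.
by apply/funext => y; rewrite /dom /= EFinM.
Qed.

Lemma continuous_primitive_param a : (forall y, continuous (psi y)) ->
  continuous (fun s => primitive (psi ^~ s) a).
Proof.
move=> psic t.
have mI : measurable (`]-oo, a]%classic : set (measurableTypeR R)) by [].
have := @continuity_under_integral R _ (measurableTypeR R) leb
  (fun s y => psi y s) _ mI (t - 1) (t + 1) _ _ dom (dom_integrable mI).
apply.
- by move=> s _; exact: (vanishes_integrableS mI (@psi_cont s) (@psi_vanish s)).
- by apply: aeW => y _ s _; exact: psic.
- by move=> s _; apply: aeW => y _; exact: psi_dom.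
- by rewrite inE/= in_itv/= ltrBlDr ltrDl ltr01.
Qed.

Lemma is_derive_primitive_param (phi : R -> R -> R) a t :
  (forall s, continuous (phi ^~ s)) ->
  (forall s, vanishes_outside L (phi ^~ s)) ->
  (forall y s, is_derive s (1 : R) (phi y) (psi y s)) ->
  is_derive t (1 : R) (fun s => primitive (phi ^~ s) a) (primitive (psi ^~ t) a).
Proof.
move=> phic phi0 dphi.
have mI : measurable (`]-oo, a]%classic : set (measurableTypeR R)) by [].
have dE s y : partial1of2 (fun s y => phi y s) s y = psi y s.
  by rewrite partial1of2E; apply: derive_val.
have It : `](t - 1), (t + 1)[%classic t.
  by rewrite /= in_itv/= ltrBlDr ltrDl ltr01.
have := @cvg_differentiation_under_integral R _ (measurableTypeR R) leb
  (fun s y => phi y s) _ mI t (t - 1) (t + 1) It _ _ dom _ (dom_integrable mI).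
move=> H; apply/is_derive_cvgP.
have -> : primitive (psi ^~ t) a = \int[leb]_(y in `]-oo, a]) partial1of2 (fun s y => phi y s) t y.
  by rewrite /primitive; apply: eq_Rintegral => y _; rewrite dE.
apply: H.
- by move=> s _; apply: (vanishes_integrableS mI (phic s) (phi0 s)).
- by move=> s y _ _; case: (dphi y s).
- by move=> y; rewrite (le_trans _ (psi_dom y 0)).
- by move=> s y _ _; rewrite dE.
Qed.
End parameters.

(** * Supports and bounds of test functions *)

Section test_functions.
Context {R : realType}.

Lemma bounded_of_vanishing (g : R * R -> R) L : continuous g ->
  (forall y t, L <= `|y| \/ L <= `|t| -> g (y, t) = 0) ->
  exists K, forall p, `|g p| <= K.
Proof.
move=> cg g0.
have cB : compact (`[- L, L]%classic `*` `[- L, L]%classic : set (R * R)).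
  by apply: compact_setX; exact: segment_compact.
have /compact_bounded[M [_ MK]] := continuous_compact (continuous_subspaceT cg) cB.
exists (`|M| + 1) => -[y t].
have [yL|yL] := leP L `|y|; first by rewrite g0 ?normr0 ?addr_ge0//; left.
have [tL|tL] := leP L `|t|; first by rewrite g0 ?normr0 ?addr_ge0//; right.
apply: MK; first by rewrite ltr_pwDr// ler_norm.
by exists (y, t) => //; split; rewrite /= in_itv/= -ler_norml ltW.
Qed.

Lemma continuous_slice1 (g : R * R -> R) t : continuous g -> continuous (fun y => g (y, t)).
Proof.
move=> cg y; apply: (@continuous_comp _ _ _ (fun y => (y, t)) g); last exact: cg.
exact: (cvg_pair cvg_id (cvg_cst t)).
Qed.

Lemma continuous_slice2 (g : R * R -> R) y : continuous g -> continuous (fun t => g (y, t)).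
Proof.
move=> cg t; apply: (@continuous_comp _ _ _ (fun t => (y, t)) g); last exact: cg.
exact: (cvg_pair (cvg_cst y) cvg_id).
Qed.

Lemma derive1_eq0_near (f : R -> R) (y : R) : (\near y, f y = 0) -> derive1 f y = 0.
Proof.
move=> f0; rewrite derive1E (@near_eq_derive _ _ _ _ (cst 0))// derive_cst//.
Qed.

Lemma test_function_bounds (phi : R * R -> R) : test_function phi ->
  exists L K : R, [/\ 0 < L,
    forall y t, L <= `|y| \/ L <= `|t| ->
      [/\ phi (y, t) = 0, dx phi y t = 0 & dt phi y t = 0],
    forall y t, `|dx phi y t| <= K & forall y t, `|dt phi y t| <= K].
Proof.
move=> [_ _ cdx cdt /compact_bounded[M [_ MB]]].
have phi0 y t : `|M| + 1 <= `|y| \/ `|M| + 1 <= `|t| -> phi (y, t) = 0.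
  move=> yt; apply: contrapT => /eqP nz.
  (* The support bound holds for every radius above M; half a unit more than [|M|] is enough to
     contradict a distance of at least [|M| + 1]. *)
  have : `|(y, t)| <= `|M| + 2^-1.
    by apply: MB; [rewrite ltr_pwDr// ler_norm|exact: subset_closure].
  rewrite prod_normE/= ge_max => /andP[].
  by case: yt; lra.
have far (y : R) : `|M| + 2 <= `|y| -> \near y, `|M| + 1 <= `|y|.
  move=> My; near=> z.
  have : `|y - z| < 1 by near: z; exact: cvgr_dist_lt.
  by have := ler_normD z (y - z); rewrite subrKC; lra.
(* One further unit of distance leaves a neighbourhood on which phi vanishes, so the derivatives
   vanish as well. *)
have d0 y t : `|M| + 2 <= `|y| \/ `|M| + 2 <= `|t| ->
    [/\ phi (y, t) = 0, dx phi y t = 0 & dt phi y t = 0].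
  move=> yt; split.
  - by apply: phi0; case: yt => ?; [left|right]; lra.
  - apply: derive1_eq0_near; case: yt => [/far h|h].
      by near=> z; apply: phi0; left; near: z.
    by near=> z; apply: phi0; right; lra.
  - apply: derive1_eq0_near; case: yt => [h|/far h].
      by near=> z; apply: phi0; left; lra.
    by near=> z; apply: phi0; right; near: z.
have [||K1 hK1] := @bounded_of_vanishing (fun p => dx phi p.1 p.2) (`|M| + 2) => //.
  by move=> y t /d0[].
have [||K2 hK2] := @bounded_of_vanishing (fun p => dt phi p.1 p.2) (`|M| + 2) => //.
  by move=> y t /d0[].
exists (`|M| + 2), (Num.max K1 K2); split => //.
- by move=> y t; rewrite le_max (hK1 (y, t)).
- by move=> y t; rewrite le_max (hK2 (y, t)) orbT.
Unshelve. all: by end_near. Qed.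
End test_functions.

(** * Pointwise rules of differentiation *)

Section pointwise_calculus.
Context {R : realType}.
Implicit Types (f g : R -> R) (t a b : R).

Lemma is_derive_fadd f g t a b : is_derive t (1 : R) f a -> is_derive t (1 : R) g b ->
  is_derive t (1 : R) (fun s => f s + g s) (a + b).
Proof. by move=> ? ?; exact: is_deriveD. Qed.

Lemma is_derive_fsub f g t a b : is_derive t (1 : R) f a -> is_derive t (1 : R) g b ->
  is_derive t (1 : R) (fun s => f s - g s) (a - b).
Proof. by move=> ? ?; exact: is_deriveB. Qed.

Lemma is_derive_fmul f g t a b : is_derive t (1 : R) f a -> is_derive t (1 : R) g b ->
  is_derive t (1 : R) (fun s => f s * g s) (f t * b + g t * a).
Proof. by move=> ? ?; exact: is_deriveM. Qed.

Lemma is_derive_fscale c g t b : is_derive t (1 : R) g b ->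
  is_derive t (1 : R) (fun s => c * g s) (c * b).
Proof. by move=> ?; exact: is_deriveZ. Qed.

Lemma is_derive_continuous f t a : is_derive t (1 : R) f a -> {for t, continuous f}.
Proof. by move=> [df _]; apply/differentiable_continuous/derivable1_diffP. Qed.
End pointwise_calculus.

(** * Balance laws for waves *)

Section balance.
Context {R : realType}.
Local Notation leb := (@lebesgue_measure R).

(** A common description of rho, m and n: constant outer coefficients and a time-dependent weight of
    the atom. L stays free because each test function brings its own. *)
Definition represents (p : R -> signed_radon R) (c1 c2 : R) (c3 x z : R -> R) :=
  forall t, 0 <= t -> forall L f, continuous f -> vanishes_outside L f ->
    pairing (p t) f = wave_pairing c1 c2 (c3 t) (x t) (z t) L f.

Lemma Cc_vanishes (f : R -> R) : Cc f -> exists L, vanishes_outside L f.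
Proof.
move=> [_ /compact_bounded[M [_ MB]]]; exists (`|M| + 2) => y My.
apply: contrapT => /eqP nz.
have : `|y| <= `|M| + 1.
  by apply: MB; [rewrite ltr_pwDr// ler_norm|exact: subset_closure].
by lra.
Qed.

Lemma represents_weakly_continuous p c1 c2 c3 x z :
  represents p c1 c2 c3 x z ->
  (forall t : R, 0 <= t -> {for t, continuous c3}) ->
  (forall t : R, 0 <= t -> {for t, continuous x}) ->
  (forall t : R, 0 <= t -> {for t, continuous z}) ->
  weakly_continuous p.
Proof.
move=> rp cc3 cx cz f fC; have [cf _] := fC; have [L f0] := Cc_vanishes fC.
apply: (@subspace_eq_continuous _ _ _
  (fun t => wave_pairing c1 c2 (c3 t) (x t) (z t) L f)).
  by move=> t; rewrite inE/= => t0; exact/esym/rp.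
apply: continuous_in_subspaceT => t; rewrite inE/= => t0.
have cprim y : {for y, continuous (primitive f)}.
  exact: is_derive_continuous (is_derive_primitive y cf f0).
have cpx := @continuous_comp _ _ _ x (primitive f) t (cx t t0) (cprim _).
have cpz := @continuous_comp _ _ _ z (primitive f) t (cz t t0) (cprim _).
have cfx := @continuous_comp _ _ _ x f t (cx t t0) (cf _).
rewrite /wave_pairing.
exact: (cvgD (cvgD (cvgM (cvg_cst c1) cpx)
  (cvgM (cvg_cst c2) (cvgB (cvg_cst (primitive f L)) cpz))) (cvgM (cc3 t t0) cfx)).
Qed.

Lemma Rintegral_half_line L (f g : R -> R) :
  (forall t : R, 0 <= t -> f t = g t) -> (forall t, L <= t -> g t = 0) ->
  \int[leb]_(t in [set t : R | 0 <= t]) f t = \int[leb]_(t in `[0, L]) g t.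
Proof.
move=> fg g0; rewrite Rintegral_mkcond [RHS]Rintegral_mkcond.
apply: eq_Rintegral => t _; rewrite !patchE.
case: ifPn => [|]; rewrite ?notin_setE ?inE/= => t0; last first.
  by rewrite memNset//= in_itv/= => /andP[].
rewrite fg//; case: ifPn => //; rewrite notin_setE/= in_itv/= t0/= => /negP.
by rewrite -ltNge => /ltW/g0.
Qed.

(* The last hypothesis is the Rankine-Hugoniot condition; the arbitrary h merges
   the two jumps when z = x. *)
Lemma balance_law_wave (p q : R -> signed_radon R) (c1 c2 v1 v2 : R)
    (b b' x x' z z' : R -> R) :
  (forall t : R, 0 <= t -> is_derive t (1 : R) x (x' t)) ->
  (forall t : R, 0 <= t -> is_derive t (1 : R) z (z' t)) ->
  (forall t : R, 0 <= t -> is_derive t (1 : R) b (b' t)) ->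
  (forall t : R, 0 <= t -> {for t, continuous x'}) ->
  represents p c1 c2 b x z ->
  represents q (c1 * v1) (c2 * v2) (fun t => b t * x' t) x z ->
  (forall t : R, 0 <= t -> forall h : R -> R,
    (c1 * (x' t - v1) + b' t) * h (x t) + c2 * (v2 - z' t) * h (z t) = 0) ->
  balance_law p q.
Proof.
move=> dxt dzt dbt cx' rp rq jump phi tphi.
have [L [K [L0 phi0 dxK dtK]]] := test_function_bounds tphi.
have [derx dert cdx cdt _] := tphi.
have phix y t : is_derive y (1 : R) (fun y => phi (y, t)) (dx phi y t).
  by apply: DeriveDef; rewrite ?/dx ?derive1E.
have phit y t : is_derive t (1 : R) (fun t => phi (y, t)) (dt phi y t).
  by apply: DeriveDef; rewrite ?/dt ?derive1E.
(* Joint continuity of phi is derived: the bound on [dx phi] makes phi Lipschitz in space, and phi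
   is continuous in time at each fixed point. *)
have cphi : continuous phi.
  move=> [y t]; rewrite (_ : phi = fun r => phi (r.1, r.2)); last first.
    by apply/funext => -[].
  apply: (@continuous_along _ _ (y, t) (fun a s => phi (a, s)) K fst snd).
  - move=> a c s; have [d _ ->] := mean_value c a (phix ^~ s).
    by rewrite normrM ler_wpM2r.
  - exact: cvg_fst.
  - exact: cvg_snd.
  - exact: is_derive_continuous (phit _ _).
have cphis t : continuous (fun y => phi (y, t)) by exact: continuous_slice1.
have cdts t : continuous (fun y => dt phi y t).
  exact: (@continuous_slice1 _ (fun r => dt phi r.1 r.2) t cdt).
have cdxs t : continuous (fun y => dx phi y t).
  exact: (@continuous_slice1 _ (fun r => dx phi r.1 r.2) t cdx).
have phiv t : vanishes_outside L (fun y => phi (y, t)) by move=> y yL; case: (phi0 y t) => //; left.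
have dxv t : vanishes_outside L (fun y => dx phi y t) by move=> y yL; case: (phi0 y t) => //; left.
have dtv t : vanishes_outside L (fun y => dt phi y t) by move=> y yL; case: (phi0 y t) => //; left.
(* The spatial primitives of phi and of its time derivative; Phi has the partial derivatives phi and
   Psi. *)
pose Phi a t := primitive (fun y => phi (y, t)) a.
pose Psi a t := primitive (fun y => dt phi y t) a.
have Phix a t : is_derive a (1 : R) (Phi ^~ t) (phi (a, t)).
  exact: is_derive_primitive (cphis t) (phiv t).
have Phit a t : is_derive t (1 : R) (Phi a) (Psi a t).
  exact: (@is_derive_primitive_param _ L K (dt phi) dtv dtK (fun y s => phi (y, s)) a t).
(* For t >= 0, A and B are the two integrands of the balance law, and I is the pairing of p(t) with
   phi(., t), whose derivative is to be A + B. *)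
pose A t := wave_pairing c1 c2 (b t) (x t) (z t) L (fun y => dt phi y t).
pose B t := c1 * v1 * phi (x t, t) - c2 * v2 * phi (z t, t) + b t * x' t * dx phi (x t) t.
pose I t := wave_pairing c1 c2 (b t) (x t) (z t) L (fun y => phi (y, t)).
have pairA (t : R) : 0 <= t -> pairing (p t) (fun y => dt phi y t) = A t.
  by move=> t0; rewrite (rp t t0 L).
have pairB (t : R) : 0 <= t -> pairing (q t) (fun y => dx phi y t) = B t.
  move=> t0; rewrite (rq t t0 L)// /wave_pairing.
  rewrite !(primitive_derive _ (cdxs t) (dxv t) (phix ^~ t) (phiv t)).
  have -> : phi (L, t) = 0 by apply: phiv; rewrite ger0_norm// ltW.
  by rewrite sub0r mulrN.
have wave0 u v w : wave_pairing c1 c2 u v w L (cst (0 : R)) = 0.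
  by rewrite /wave_pairing /primitive !Rintegral_cst// !mul0r subrr !mulr0 !addr0.
have Aend (t : R) : L <= t -> A t = 0.
  move=> Lt; rewrite /A (_ : (fun y => dt phi y t) = cst 0) ?wave0//.
  apply/funext => y; case: (phi0 y t) => //; right; rewrite ger0_norm//.
  by rewrite (le_trans (ltW L0)).
have Bend t : L <= t -> B t = 0.
  move=> Lt; have far (y : R) : L <= `|y| \/ L <= `|t|.
    by right; rewrite ger0_norm// (le_trans (ltW L0)).
  have [e1 e2 _] := phi0 (x t) t (far _); have [e3 _ _] := phi0 (z t) t (far _).
  by rewrite /B e1 e2 e3 !mulr0 subrr addr0.
have IL : I L = 0.
  rewrite /I (_ : (fun y => phi (y, L)) = cst 0) ?wave0//.
  by apply/funext => y; case: (phi0 y L) => //; right; rewrite ger0_norm// ltW.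
have Ider (t : R) : 0 <= t -> is_derive t (1 : R) I (A t + B t).
  move=> t0.
  have cpair : {for (x t, t), continuous (fun r : R * R => phi (r.1, r.2))}.
    by move: (cphi (x t, t)); rewrite (_ : phi = fun r => phi (r.1, r.2))//; apply/funext => -[].
  have cpairz : {for (z t, t), continuous (fun r : R * R => phi (r.1, r.2))}.
    by move: (cphi (z t, t)); rewrite (_ : phi = fun r => phi (r.1, r.2))//; apply/funext => -[].
  have d1 := is_derive_along (D := fun a s => phi (a, s)) Phix cpair (dxt t t0) (Phit (x t) t).
  have d2 := is_derive_along (D := fun a s => phi (a, s)) Phix cpairz (dzt t t0) (Phit (z t) t).
  have d3 := is_derive_along (F := fun a s => phi (a, s)) phix (cdx (x t, t))
    (dxt t t0) (phit (x t) t).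
  have dI := is_derive_fadd (is_derive_fadd (is_derive_fscale c1 d1)
    (is_derive_fscale c2 (is_derive_fsub (Phit L t) d2))) (is_derive_fmul (dbt t t0) d3).
  apply: (is_derive_eq dI); rewrite /A /B /wave_pairing -/(Psi _ _) -/(Psi _ _) -/(Psi _ _).
  (* I' - A - B consists of boundary terms at x t and z t only: it is the jump expression with h =
     phi(., t). *)
  by have := jump t t0 (fun y => phi (y, t)); lra.
have cA (t : R) : 0 <= t -> {for t, continuous A}.
  move=> t0.
  have Psix a s : is_derive a (1 : R) (Psi ^~ s) (dt phi a s).
    exact: is_derive_primitive (cdts s) (dtv s).
  have along w : {for t, continuous w} -> {for t, continuous (fun s => Psi (w s) s)}.
    move=> cw; apply: (@continuous_along _ _ t Psi K w id) => //.
      move=> a c s; have [d _ ->] := mean_value c a (Psix ^~ s).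
      by rewrite normrM ler_wpM2r.
    apply: (@continuous_primitive_param _ L K (dt phi) cdts dtv dtK) => y.
    exact: (@continuous_slice2 _ (fun r => dt phi r.1 r.2) y cdt).
  have cx := is_derive_continuous (dxt t t0).
  have cz := is_derive_continuous (dzt t t0).
  have cb := is_derive_continuous (dbt t t0).
  have cd : {for t, continuous (fun s => dt phi (x s) s)}.
    apply: (@continuous_comp _ _ _ (fun s => (x s, s)) (fun r : R * R => dt phi r.1 r.2)).
      exact: (cvg_pair cx cvg_id).
    exact: cdt.
  exact: (cvgD (cvgD (cvgM (cvg_cst c1) (along x cx))
    (cvgM (cvg_cst c2) (cvgB (along (fun=> L) (cvg_cst _)) (along z cz)))) (cvgM cb cd)).
have cB (t : R) : 0 <= t -> {for t, continuous B}.
  move=> t0.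
  have cx := is_derive_continuous (dxt t t0).
  have cz := is_derive_continuous (dzt t t0).
  have cb := is_derive_continuous (dbt t t0).
  have cd : {for t, continuous (fun s => dx phi (x s) s)}.
    apply: (@continuous_comp _ _ _ (fun s => (x s, s)) (fun r : R * R => dx phi r.1 r.2)).
      exact: (cvg_pair cx cvg_id).
    exact: cdx.
  have cphix : {for t, continuous (fun s => phi (x s, s))}.
    apply: (@continuous_comp _ _ _ (fun s => (x s, s)) phi); last exact: cphi.
    exact: (cvg_pair cx cvg_id).
  have cphiz : {for t, continuous (fun s => phi (z s, s))}.
    apply: (@continuous_comp _ _ _ (fun s => (z s, s)) phi); last exact: cphi.
    exact: (cvg_pair cz cvg_id).
  exact: (cvgD (cvgB (cvgM (cvg_cst (c1 * v1)) cphix) (cvgM (cvg_cst (c2 * v2)) cphiz))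
    (cvgM (cvgM cb (cx' t t0)) cd)).
have within0 (f : R -> R) : (forall t : R, 0 <= t -> {for t, continuous f}) ->
    {within `[0, L], continuous f}.
  move=> cf; apply: continuous_in_subspaceT => t.
  by rewrite inE/= in_itv/= => /andP[t0 _]; exact: cf.
have int0 (f : R -> R) : (forall t : R, 0 <= t -> {for t, continuous f}) ->
    leb.-integrable `[0, L] (EFin \o f).
  by move=> cf; apply: continuous_compact_integrable; [exact: segment_compact|exact: within0].
(* Both integrals reduce to [0, L], where the fundamental theorem gives I L - I 0; here I L = 0, and
   I 0 is the initial term. *)
rewrite (Rintegral_half_line pairA Aend) (Rintegral_half_line pairB Bend).
rewrite -RintegralD//; [|exact: int0|exact: int0].
rewrite /Rintegral (@continuous_FTC2 _ _ I)//.
- rewrite IL -EFinB sub0r /= (rp 0 (lexx 0) L)//.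
  by rewrite addNr.
- by apply: within0 => t t0; exact: (cvgD (cA t t0) (cB t t0)).
- split.
  + by move=> t; rewrite in_itv/= => /andP[/ltW t0 _]; case: (Ider t t0).
  + exact/cvg_at_right_filter/(is_derive_continuous (Ider 0 (lexx 0))).
  + exact/cvg_at_left_filter/(is_derive_continuous (Ider L (ltW L0))).
- move=> t; rewrite in_itv/= => /andP[/ltW t0 _].
  by rewrite derive1E; have [_ ->] := Ider t t0.
Qed.
End balance.

(** * One-sided derivatives and Lipschitz bounds on the half-line *)

Section half_line.
Context {R : realType}.
Implicit Types (f F : R -> R) (t l : R).

(** Properness makes the limits defining [half_derive] unique; the points t + r / 2 differ from t
    and remain in the half-line, also at t = 0. *)
Lemma half_filter_proper t : 0 <= t -> ProperFilter (half_filter t).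
Proof.
move=> t0; apply: Build_ProperFilter_ex.
move=> P /nbhs_ballP[r /= r0 rP]; exists (t + r / 2); apply: rP => /=.
- by rewrite /ball/= opprD addrA subrr sub0r normrN gtr0_norm ?divr_gt0//; lra.
- by rewrite -subr_eq0 addrAC subrr add0r gt_eqF// divr_gt0.
- by rewrite addr_ge0// divr_ge0// ltW.
Qed.

(** Agreement at nonnegative times suffices. This allows f to be [half_derive x], which is known
    only there, and so yields second derivatives. *)
Lemma cvg_half_quotient f F t l : 0 <= t -> (forall s, 0 <= s -> f s = F s) ->
  is_derive t (1 : R) F l -> half_quotient f t @ half_filter t --> l.
Proof.
move=> t0 fF /is_derive_cvgP dF; have := half_filter_proper t0 => ?.
apply/cvgrPdist_le => e e0.
have /cvgrPdist_le/(_ _ e0) := dF.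
move=> /nbhs_ballP[r /= r0 rP].
apply/nbhs_ballP; exists r => //= s ts st s0.
rewrite /half_quotient (fF s)// (fF t)// mulrC -{2}(subrK t s).
apply: rP => /=; last by rewrite subr_eq0.
by move: ts; rewrite /ball/= sub0r normrN distrC.
Qed.

Lemma half_deriveE f F t l : 0 <= t -> (forall s, 0 <= s -> f s = F s) ->
  is_derive t (1 : R) F l -> half_derivable f t /\ half_derive f t = l.
Proof.
move=> t0 fF dF; have fl := cvg_half_quotient t0 fF dF.
have := half_filter_proper t0 => ?.
split; first by apply/cvg_ex; exists l.
by apply: cvg_lim fl.
Qed.

Lemma lipschitz_half_line (x x' : R -> R) k :
  (forall t : R, 0 <= t -> is_derive t (1 : R) x (x' t)) ->
  (forall t : R, 0 <= t -> `|x' t| <= k) -> k.-lipschitz_[set t : R | 0 <= t] x.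
Proof.
move=> dx bx [s t] [/= s0 t0].
wlog st : s t s0 t0 / s <= t.
  move=> H; have [/H|/ltW/H] := leP s t; first exact.
  by rewrite distrC (distrC t); exact.
have dxi y : y \in `[s, t] -> is_derive y (1 : R) x (x' y).
  by rewrite in_itv/= => /andP[sy _]; apply: dx; exact: le_trans sy.
rewrite distrC (distrC s).
have dxo y : y \in `]s, t[ -> is_derive y (1 : R) x (x' y).
  by move=> yst; apply: dxi; exact: subset_itv_oo_cc yst.
have cxi : {within `[s, t], continuous x}.
  by apply: derivable_within_continuous => y /dxi[].
have [c] := MVT_segment st dxo cxi.
rewrite in_itv/= => /andP[sc _] ->; rewrite normrM ler_wpM2r//.
by apply: bx; exact: le_trans sc.
Qed.
End half_line.

(** * From jump conditions to delta shock solutions *)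

Section solution.
Context {R : realType}.
Local Notation leb := (@lebesgue_measure R).

(** Cutting the right density off below z turns its integral into r2 times the measure of
    [right_of]. *)
Lemma wave_shock_density r1 (r2 : R) (rt : R -> R -> R) (x a : R -> R) (z t : R)
    (A : set (measurableTypeR R)) :
  0 <= r1 -> 0 <= r2 -> 0 <= a t -> measurable A ->
  (forall y, x t < y -> rt y t = if y < z then 0 else r2) ->
  radon_wave r1 r2 (a t) (x t) z A = shock_density r1 rt x a t A.
Proof.
move=> r10 r20 at0 mA rtE; rewrite [LHS]waveE !max_r// /shock_density.
congr (_ + _ + _)%E.
have mx : measurable ([set y | x t < y] : set (measurableTypeR R)).
  rewrite (_ : [set y | _] = [set` `]x t, +oo[%R])//.
  by apply/seteqP; split => y /=; rewrite in_itv/= andbT.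
rewrite -integral_cst; last first.
  by apply: measurableI => //; exact: measurable_right_of.
rewrite (_ : A `&` right_of (x t) z = (A `&` [set y | x t < y]) `&` [set y | z <= y]).
  rewrite integral_mkcondr; apply: eq_integral => y; rewrite inE => -[_ /= xy].
  rewrite patchE rtE//; case: ifPn; rewrite ?notin_setE ?inE/=.
    by rewrite leNgt => /negbTE->.
  by move=> /negP; rewrite -ltNge => ->.
by rewrite -setIA; congr (_ `&` _).
Qed.

Variables (r1 r2 m0 u0 u1 u2 : R).
Variables (v2 : R -> R -> option R) (x x' x'' a a' z z' : R -> R).
Hypotheses (r1_ge0 : 0 <= r1) (r2_ge0 : 0 <= r2).
Hypothesis dx1 : forall t : R, 0 <= t -> is_derive t (1 : R) x (x' t).
Hypothesis dx2 : forall t : R, 0 <= t -> is_derive t (1 : R) x' (x'' t).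
Hypothesis da : forall t : R, 0 <= t -> is_derive t (1 : R) a (a' t).
Hypothesis dz : forall t : R, 0 <= t -> is_derive t (1 : R) z (z' t).
Hypothesis a_ge0 : forall t : R, 0 <= t -> 0 <= a t.
Hypothesis xz : forall t : R, 0 <= t -> x t <= z t.
Hypothesis v2E : forall y t : R, 0 <= t -> x t < y -> z t <= y -> v2 y t = Some u2.
Hypotheses (x0 : x 0 = 0) (x'0 : x' 0 = u0) (a0 : a 0 = m0) (z0 : z 0 = 0).
(** The jump conditions for mass and momentum. In the second one the weight of the atom is a x',
    whose derivative is a x'' + x' a'. *)
Hypothesis mass : forall t : R, 0 <= t -> forall h : R -> R,
  (r1 * (x' t - u1) + a' t) * h (x t) + r2 * (u2 - z' t) * h (z t) = 0.
Hypothesis momentum : forall t : R, 0 <= t -> forall h : R -> R,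
  (r1 * u1 * (x' t - u1) + (a t * x'' t + x' t * a' t)) * h (x t)
  + r2 * u2 * (u2 - z' t) * h (z t) = 0.

(** Momentum and flux are waves on the same pieces, with coefficients multiplied by the velocity
    once and twice; [balance_law_wave] therefore serves for (rho, m) and again for (m, n). *)
Lemma wave_measure_solution :
  measure_solution (riemann_rho r1 m0 r2) (riemann_u u1 u0 u2)
    (fun t => radon_wave r1 r2 (a t) (x t) (z t)) (shock_velocity u1 v2 x).
Proof.
pose m t := signed_wave (r1 * u1) (r2 * u2) (a t * x' t) (x t) (z t).
pose n t := signed_wave (r1 * u1 ^+ 2) (r2 * u2 ^+ 2) (a t * x' t ^+ 2) (x t) (z t).
have rrho : represents (fun t => signed_of_radon (radon_wave r1 r2 (a t) (x t) (z t)))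
    r1 r2 a x z.
  move=> t t0 L f cf f0; apply: pairing_radon_wave => //; [exact: a_ge0|exact: xz].
have rm : represents m (r1 * u1) (r2 * u2) (fun t => a t * x' t) x z.
  by move=> t t0 L f cf f0; apply: pairing_signed_wave => //; exact: xz.
have rn : represents n (r1 * u1 * u1) (r2 * u2 * u2) (fun t => a t * x' t * x' t) x z.
  move=> t t0 L f cf f0; rewrite -!mulrA -!expr2.
  by apply: pairing_signed_wave => //; exact: xz.
have cx t t0 := is_derive_continuous (@dx1 t t0).
have cx' t t0 := is_derive_continuous (@dx2 t t0).
have ca t t0 := is_derive_continuous (@da t t0).
have cz t t0 := is_derive_continuous (@dz t t0).
have dax (t : R) : 0 <= t -> is_derive t (1 : R) (fun t => a t * x' t) (a t * x'' t + x' t * a' t).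
  by move=> t0; exact: is_derive_fmul (da t0) (dx2 t0).
have cax (t : R) : 0 <= t -> {for t, continuous (fun t => a t * x' t)}.
  by move=> t0; exact: is_derive_continuous (dax t t0).
have caxx (t : R) : 0 <= t -> {for t, continuous (fun t => a t * x' t * x' t)}.
  by move=> t0; exact: (cvgM (cax t t0) (cx' t t0)).
have hx (t : R) : 0 <= t -> half_derive x t = x' t.
  by move=> t0; have [] := half_deriveE t0 (fun _ _ => erefl) (dx1 t0).
have velocity (t : R) : 0 <= t -> {ae radon_wave r1 r2 (a t) (x t) (z t),
    forall y, shock_velocity u1 v2 x y t = Some (wave_velocity u1 u2 (x' t) (x t) y)}.
  (* The partial and the total velocity can differ only in the gap between x and z, which is null
     for the wave. *)
  move=> t0; exists [set` `]x t, z t[%R]; split => //.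
    apply: wave_eq0.
    - right; rewrite -subset0 => y [/=]; rewrite in_itv/= => /andP[xy _].
      by rewrite /left_of/= => /(lt_trans xy); rewrite ltxx.
    - right; rewrite -subset0 => y [/=]; rewrite in_itv/= => /andP[_ yz].
      by move=> [_ /=]; rewrite leNgt yz.
    - by right; rewrite /= in_itv/= ltxx.
  move=> y /= ne; rewrite in_itv/=; apply: contrapT => yxz; apply: ne.
  rewrite /shock_velocity /wave_velocity hx//.
  have [//|xy|//] := ltgtP y (x t).
  apply: v2E => //; rewrite leNgt; apply/negP => yz.
  by apply: yxz; rewrite xy.
exists m, n; split.
- split.
  + exact: (represents_weakly_continuous rrho).
  + exact: (represents_weakly_continuous rm).
  + exact: (represents_weakly_continuous rn).
- split.
  + exact: (balance_law_wave dx1 dz da cx' rrho rm mass).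
  + exact: (balance_law_wave dx1 dz dax cx' rm rn momentum).
- move=> A mA; rewrite [LHS]waveE x0 z0 a0 !max_r//; last by rewrite -a0 a_ge0.
  rewrite /riemann_rho addeAC; congr (_ + _ * leb (A `&` _))%E.
  apply/seteqP; split => y /=; first by case.
  by move=> y0; split => //; exact: ltW.
- rewrite (_ : riemann_u u1 u0 u2 = wave_velocity u1 u2 (x' 0) (x 0)).
    by apply: wave_density => //; exact: a_ge0.
  apply/funext => y; rewrite /riemann_u /wave_velocity x0 x'0 !indicE.
  have -> : (y \in [set y : R | y < 0]) = (y < 0) by apply/idP/idP; rewrite inE.
  have -> : (y \in [set y : R | 0 < y]) = (0 < y) by apply/idP/idP; rewrite inE.
  have -> : (y \in [set y : R | y = 0]) = (y == 0) by apply/idP/idP; rewrite inE => /eqP.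
  have [y0|y0|_] := ltgtP y 0.
  + by rewrite !mulr0 mulr1 !addr0.
  + by rewrite !mulr0 mulr1 !add0r.
  + by rewrite !mulr0 mulr1 addr0 add0r.
- move=> t t0; split.
  + split; first by apply: wave_abs_continuous => //; exact: a_ge0.
    exists (wave_velocity u1 u2 (x' t) (x t)); split; last exact: velocity.
    by apply: wave_density => //; exact: a_ge0.
  + split; first by apply: wave_abs_continuous => //; exact: a_ge0.
    exists (wave_velocity (u1 ^+ 2) (u2 ^+ 2) (x' t ^+ 2) (x t)); split.
      by apply: wave_density => //; exact: a_ge0.
    have [N [mN N0 sN]] := velocity t t0; exists N; split => // y /= ne.
    apply: sN => /= E; apply: ne; rewrite E /=.
    by rewrite /wave_velocity; case: ifP => //; case: ifP.
Qed.

Lemma wave_delta_shock (rt : R -> R -> R) : m0 != 0 ->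
  (exists k, forall t : R, 0 <= t -> `|x' t| <= k) ->
  (forall y t : R, 0 <= rt y t) ->
  (forall y t : R, 0 <= t -> x t < y -> rt y t = if y < z t then 0 else r2) ->
  delta_shock_solution (riemann_rho r1 m0 r2) (riemann_u u1 u0 u2)
    r1 u1 rt v2 x a (fun t => radon_wave r1 r2 (a t) (x t) (z t)).
Proof.
move=> m0_neq0 [k x'k] rt_ge0 rtE; split.
- split; first by exists k; exact: lipschitz_half_line dx1 x'k.
  by move=> t t0; have [] := half_deriveE t0 (fun _ _ => erefl) (dx1 t0).
- by split=> //; exists 0; rewrite a0.
- by [].
- move=> t t0 A mA; apply: wave_shock_density => //; first exact: a_ge0.
  by move=> y; exact: rtE.
- exact: wave_measure_solution.
Qed.
End solution.

(** Clearing the denominator d leaves a polynomial identity in ordinary derivatives, which is what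
    the explicit curve satisfies. *)
Lemma shock_ivpP (R : realType) (A b c m0 u0 : R) (x x' x'' : R -> R) :
  (forall t : R, 0 <= t -> is_derive t (1 : R) x (x' t)) ->
  (forall t : R, 0 <= t -> is_derive t (1 : R) x' (x'' t)) ->
  x 0 = 0 -> x' 0 = u0 ->
  (forall t : R, 0 <= t -> let d := A * x t - b * t - m0 in
     d != 0 /\ d * x'' t + (A * x' t - 2 * b) * x' t + c = 0) ->
  shock_ivp A b c m0 u0 x.
Proof.
move=> dx1 dx2 x0 x'0 ode.
have h1 t t0 := half_deriveE t0 (fun _ _ => erefl) (dx1 t t0).
have h2 t t0 := half_deriveE t0 (fun s s0 => (h1 s s0).2) (dx2 t t0).
split => //.
- by move=> t t0; have [] := h1 t t0.
- by move=> t t0; have [] := h2 t t0.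
- move=> t t0 d; have [d0 E] := ode t t0; split => //.
  rewrite (h2 t t0).2 (h1 t t0).2; apply: (mulfI d0); rewrite mulr0 -E -/d.
  by field.
- by rewrite (h1 0 (lexx 0)).2.
Qed.

(** * The shock curve *)

Section shock_curve.
Context {R : realType}.

Lemma is_derive_finv (f : R -> R) (t a : R) : f t != 0 -> is_derive t (1 : R) f a ->
  is_derive t (1 : R) (fun s => (f s)^-1) (- a / f t ^+ 2).
Proof.
move=> ft df; apply: (is_derive_eq (is_deriveV ft df)).
by rewrite /GRing.scale/= mulNr mulrC mulNr.
Qed.

Lemma is_derive_fsqrt (f : R -> R) (t a : R) : 0 < f t -> is_derive t (1 : R) f a ->
  is_derive t (1 : R) (fun s => Num.sqrt (f s)) (a / (2 * Num.sqrt (f t))).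
Proof.
move=> ft df; apply: (is_derive_eq (is_derive1_comp (is_derive1_sqrt ft) df)).
by rewrite mulrC.
Qed.

Lemma is_derive_fid (t : R) : is_derive t (1 : R) (fun s : R => s) 1.
Proof. exact: is_derive_id. Qed.

Lemma is_derive_fcst (c t : R) : is_derive t (1 : R) (fun=> c) 0.
Proof. exact: is_derive_cst. Qed.

Variables m0 r1 r2 u0 u1 u2 : R.
Hypotheses (m0_gt0 : 0 < m0) (r1_ge0 : 0 <= r1) (r2_ge0 : 0 <= r2).
Hypotheses (u20 : u2 < u0) (u01 : u0 < u1).

(** Velocities relative to u0, so that the atom starts at rest. Mass balance becomes al = m0 + B t +
    (r2 - r1) y, and momentum balance al y' = e t - B y. *)
Let v1 := u1 - u0.
Let v2 := u2 - u0.
Let B := r1 * v1 - r2 * v2.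
Let e := r1 * v1 ^+ 2 - r2 * v2 ^+ 2.
(** C equals B^2 + (r2 - r1) e, which makes S the reduced discriminant of (r2 - r1) y^2 + 2 (m0 + B
    t) y = e t^2, the integrated momentum balance. *)
Let C := r1 * r2 * (v1 - v2) ^+ 2.
Let S (t : R) := m0 ^+ 2 + 2 * m0 * B * t + C * t ^+ 2.
Let al t := Num.sqrt (S t).
Let den t := al t + (m0 + B * t).
Let y t := e * (t * t) * (den t)^-1.
Let w t := (e * t - B * y t) * (al t)^-1.
(** Obtained by differentiating al w = e t - B y and solving for the derivative of w. *)
Let w' t := (e - 2 * B * w t - (r2 - r1) * w t ^+ 2) / al t.

Let v1_gt0 : 0 < v1. Proof. by rewrite subr_gt0. Qed.
Let v2_lt0 : v2 < 0. Proof. by rewrite subr_lt0. Qed.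
Let B_ge0 : 0 <= B.
Proof. by rewrite /B -mulrN addr_ge0// mulr_ge0// ?oppr_ge0 ltW. Qed.
Let S_gt0 t : 0 <= t -> 0 < S t.
Proof.
move=> t0; rewrite /S /C -addrA ltr_pwDl ?exprn_gt0// addr_ge0//.
  by rewrite !mulr_ge0// ltW.
by rewrite mulr_ge0 ?sqr_ge0// mulr_ge0 ?sqr_ge0// mulr_ge0.
Qed.
Let al_gt0 t : 0 <= t -> 0 < al t.
Proof. by move=> t0; rewrite sqrtr_gt0 S_gt0. Qed.
Let al_sqr t : 0 <= t -> al t ^+ 2 = S t.
Proof. by move=> t0; rewrite sqr_sqrtr// ltW// S_gt0. Qed.
Let den_gt0 t : 0 <= t -> 0 < den t.
Proof. by move=> t0; rewrite /den ltr_pwDl ?al_gt0// addr_ge0 ?(ltW m0_gt0)// mulr_ge0. Qed.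
Let y_den t : 0 <= t -> y t * den t = e * (t * t).
Proof. by move=> t0; rewrite /y -mulrA mulVf ?mulr1// lt0r_neq0// den_gt0. Qed.
(** Multiplied by [den], the identity becomes al^2 = S: the square root is the mass of the atom. *)
Let alE t : 0 <= t -> al t = m0 + B * t + (r2 - r1) * y t.
Proof.
move=> t0; have d0 := lt0r_neq0 (den_gt0 t0).
apply: (mulIf d0); rewrite [RHS]mulrDl -(mulrA (r2 - r1)) y_den//.
have := al_sqr t0; rewrite /S /den /C /B /e => h.
have -> : al t * (al t + (m0 + (r1 * v1 - r2 * v2) * t)) =
   al t ^+ 2 + al t * (m0 + (r1 * v1 - r2 * v2) * t) by ring.
by rewrite h; ring.
Qed.
(** Multiplication by [den] removes the quotient, and what remains is a sum of nonnegative terms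
    because v2 < 0 < v1. *)
Let y_le t : 0 <= t -> y t <= v1 * t.
Proof.
move=> t0; rewrite -(ler_pM2r (den_gt0 t0)) y_den// -subr_ge0.
rewrite (_ : _ - _ = v1 * t * (al t + m0) + (r2 * v2 ^+ 2 + r2 * v1 * - v2) * t ^+ 2); last first.
  by rewrite /den /e /B; ring.
have a0 := ltW (al_gt0 t0); have v10 := ltW v1_gt0; have v20 := ltW v2_lt0.
by rewrite addr_ge0// mulr_ge0 ?sqr_ge0// ?addr_ge0 ?(ltW m0_gt0)// mulr_ge0 ?sqr_ge0// ?oppr_ge0// mulr_ge0.
Qed.
Let y_ge t : 0 <= t -> v2 * t <= y t.
Proof.
move=> t0; rewrite -(ler_pM2r (den_gt0 t0)) y_den// -subr_ge0.
rewrite (_ : _ - _ = - v2 * t * (al t + m0) + (r1 * v1 ^+ 2 + r1 * v1 * - v2) * t ^+ 2); last first.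
  by rewrite /den /e /B; ring.
have a0 := ltW (al_gt0 t0); have v10 := ltW v1_gt0; have v20 := ltW v2_lt0.
by rewrite addr_ge0// mulr_ge0 ?sqr_ge0// ?addr_ge0 ?(ltW m0_gt0)// mulr_ge0 ?sqr_ge0// ?oppr_ge0// mulr_ge0.
Qed.
Let alw t : 0 <= t -> al t * w t = e * t - B * y t.
Proof. by move=> t0; rewrite /w mulrC -mulrA mulVf ?mulr1// lt0r_neq0// al_gt0. Qed.
(** After multiplication by [al], the upper bound on the speed rests on the lower bound on the
    position; the lower bound on the speed rests on the upper one. *)
Let w_le t : 0 <= t -> w t <= v1.
Proof.
move=> t0; rewrite -(ler_pM2l (al_gt0 t0)) alw// -subr_ge0 alE//.
rewrite (_ : _ - _ = m0 * v1 + r2 * (v1 - v2) * (y t - v2 * t)); last by rewrite /e /B; ring.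
have v10 := ltW v1_gt0; have v20 := ltW v2_lt0; have m00 := ltW m0_gt0.
have v12 : 0 <= v1 - v2 by rewrite subr_ge0 (le_trans v20).
have yv : 0 <= y t - v2 * t by rewrite subr_ge0 y_ge.
by rewrite addr_ge0// mulr_ge0// mulr_ge0.
Qed.
Let w_ge t : 0 <= t -> v2 <= w t.
Proof.
move=> t0; rewrite -(ler_pM2l (al_gt0 t0)) alw// -subr_ge0 alE//.
rewrite (_ : _ - _ = m0 * - v2 + r1 * (v1 - v2) * (v1 * t - y t)); last by rewrite /e /B; ring.
have v10 := ltW v1_gt0; have v20 := ltW v2_lt0; have m00 := ltW m0_gt0.
have v12 : 0 <= v1 - v2 by rewrite subr_ge0 (le_trans v20).
have yv : 0 <= v1 * t - y t by rewrite subr_ge0 y_le.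
by rewrite addr_ge0// mulr_ge0 ?oppr_ge0// mulr_ge0.
Qed.
Let dal (t : R) : 0 <= t -> is_derive t (1 : R) al ((r2 - r1) * w t + B).
Proof.
move=> t0.
have dS : is_derive t (1 : R) S (2 * m0 * B + C * (t + t)).
  have dSt := is_derive_fadd (is_derive_fadd (is_derive_fcst (m0 ^+ 2) t)
    (is_derive_fscale (2 * m0 * B) (is_derive_fid t)))
    (is_derive_fscale C (is_derive_fmul (is_derive_fid t) (is_derive_fid t))).
  by apply: (is_derive_eq dSt); rewrite add0r !mulr1.
apply: (is_derive_eq (is_derive_fsqrt (S_gt0 t0) dS)); rewrite -/(al t).
have a0 := lt0r_neq0 (al_gt0 t0).
(* The right-hand side is half the derivative of S. *)
have E : al t * ((r2 - r1) * w t + B) = m0 * B + C * t.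
  rewrite mulrDr mulrCA alw// alE// /C /B /e; ring.
apply: (mulfI a0); rewrite E; field; exact: a0.
Qed.
Let dy (t : R) : 0 <= t -> is_derive t (1 : R) y (w t).
Proof.
move=> t0; have a0 := lt0r_neq0 (al_gt0 t0); have d0 := lt0r_neq0 (den_gt0 t0).
have dden : is_derive t (1 : R) den ((r2 - r1) * w t + B + (0 + B * 1)).
  exact: is_derive_fadd (dal t0) (is_derive_fadd (is_derive_fcst m0 t)
    (is_derive_fscale B (is_derive_fid t))).
have dyt := is_derive_fmul (is_derive_fscale e (is_derive_fmul (is_derive_fid t)
  (is_derive_fid t))) (is_derive_finv d0 dden).
apply: (is_derive_eq dyt).
rewrite -y_den// add0r !mulr1; apply: (mulIf d0).
(* The two balance identities express everything through al, w and y, and so remove the explicit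
   time. *)
have h1 : m0 + B * t = al t - (r2 - r1) * y t by rewrite alE//; ring.
have h2 : e * t = al t * w t + B * y t by rewrite alw//; ring.
transitivity (- y t * ((r2 - r1) * w t + B + B) + 2 * (e * t)); first by field.
by rewrite h2 /den h1; ring.
Qed.
Let dw (t : R) : 0 <= t -> is_derive t (1 : R) w (w' t).
Proof.
move=> t0; have a0 := lt0r_neq0 (al_gt0 t0).
have dwt := is_derive_fmul (is_derive_fsub (is_derive_fscale e (is_derive_fid t))
  (is_derive_fscale B (dy t0))) (is_derive_finv a0 (dal t0)).
by apply: (is_derive_eq dwt); rewrite -alw// /w'; field.
Qed.

Lemma shock_curve_exists : exists x x' x'' : R -> R,
  [/\ x 0 = 0, x' 0 = u0 & forall t : R, 0 <= t ->
    let a := (r2 - r1) * x t - (r2 * u2 - r1 * u1) * t + m0 in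
    [/\ is_derive t (1 : R) x (x' t) /\ is_derive t (1 : R) x' (x'' t),
        0 < a, u2 <= x' t <= u1, x t <= u1 * t &
        a * x'' t + (r2 - r1) * x' t ^+ 2 - 2 * (r2 * u2 - r1 * u1) * x' t
          + (r2 * u2 ^+ 2 - r1 * u1 ^+ 2) = 0]].
Proof.
(* Return from the moving frame to the original one. *)
exists (fun t => u0 * t + y t), (fun t => u0 + w t), w'.
have y00 : y 0 = 0 by rewrite /y !mulr0 mul0r.
split; first by rewrite mulr0 add0r.
  by rewrite /w y00 !mulr0 subrr mul0r addr0.
move=> t t0 a; have aE : a = al t.
  by rewrite alE// /a /B /v1 /v2; ring.
split.
- split.
    have dxt := is_derive_fadd (is_derive_fscale u0 (is_derive_fid t)) (dy t0).
    by apply: (is_derive_eq dxt); rewrite mulr1.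
  have dxt := is_derive_fadd (is_derive_fcst u0 t) (dw t0).
  by apply: (is_derive_eq dxt); rewrite add0r.
- by rewrite aE al_gt0.
- by have := (w_le t0, w_ge t0); rewrite /v1 /v2 => -[h1 h2]; apply/andP; split; lra.
- by have := y_le t0; rewrite /v1; lra.
- rewrite aE /w' [al t * _]mulrC divfK ?lt0r_neq0 ?al_gt0//.
  by rewrite /e /B /v1 /v2; ring.
Qed.
End shock_curve.

(** * The two cases *)

Unset Implicit Arguments.
Set Strict Implicit.
Set Printing Implicit Defensive.

Theorem theorem3 (R : realType) (m0 rho1 rho2 u0 u1 u2 : R)
    (m0_gt0 : 0 < m0) (rho1_ge0 : 0 <= rho1) (rho2_ge0 : 0 <= rho2) :
  (u2 < u0 -> u0 < u1 ->
     exists (x1 : R -> R) (rho : R -> radon_measure R),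
       shock_ivp (rho1 - rho2) (rho1 * u1 - rho2 * u2)
         (rho1 * u1 ^+ 2 - rho2 * u2 ^+ 2) m0 u0 x1 /\
       delta_shock_solution (riemann_rho rho1 m0 rho2) (riemann_u u1 u0 u2)
         rho1 u1 (fun _ _ => rho2) (fun _ _ => Some u2) x1
         (fun t => (rho2 - rho1) * x1 t - (rho2 * u2 - rho1 * u1) * t + m0)
         rho) /\
  (u0 < u1 -> u1 <= u2 ->
     exists (x1 : R -> R) (rho : R -> radon_measure R),
       shock_ivp rho1 (rho1 * u1) (rho1 * u1 ^+ 2) m0 u0 x1 /\
       delta_shock_solution (riemann_rho rho1 m0 rho2) (riemann_u u1 u0 u2)
         rho1 u1 (fun x t => if x < u2 * t then 0 else rho2)
         (fun x t => if x < u2 * t then None else Some u2) x1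
         (fun t => - rho1 * x1 t + rho1 * u1 * t + m0)
         rho).
Proof.
have norm_bound (a b v : R) : a <= v <= b -> `|v| <= `|a| + `|b|.
  move=> /andP[av vb]; rewrite ler_norml.
  by have := (ler_norm b, ler_norm (- a), normr_ge0 a, normr_ge0 b);
    rewrite normrN => -[[[? ?] ?] ?]; apply/andP; split; lra.
split.
- move=> u20 u01.
  have [x [x' [x'' [x0 x'0 H]]]] := @shock_curve_exists R m0 rho1 rho2 u0 u1 u2
    m0_gt0 rho1_ge0 rho2_ge0 u20 u01.
  pose a t := (rho2 - rho1) * x t - (rho2 * u2 - rho1 * u1) * t + m0.
  pose a' t := (rho2 - rho1) * x' t - (rho2 * u2 - rho1 * u1).
  have dx1 (t : R) : 0 <= t -> is_derive t (1 : R) x (x' t) by move=> /H[[]].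
  have dx2 (t : R) : 0 <= t -> is_derive t (1 : R) x' (x'' t) by move=> /H[[]].
  have a_gt0 (t : R) : 0 <= t -> 0 < a t by move=> /H[].
  have da (t : R) : 0 <= t -> is_derive t (1 : R) a (a' t).
    move=> t0; have dat := is_derive_fadd (is_derive_fsub
      (is_derive_fscale (rho2 - rho1) (dx1 t t0))
      (is_derive_fscale (rho2 * u2 - rho1 * u1) (is_derive_fid t))) (is_derive_fcst m0 t).
    by apply: (is_derive_eq dat); rewrite mulr1 addr0.
  (* In Case 1 there is no vacuum: z is x itself, and the two jumps merge into one. *)
  exists x, (fun t => radon_wave rho1 rho2 (a t) (x t) (x t)); split.
    apply: (shock_ivpP dx1 dx2) => // t t0 d; have dE : d = - a t by rewrite /d /a; ring.
    rewrite dE oppr_eq0 gt_eqF ?a_gt0//; split => //.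
    by have [_ _ _ _] := H t t0; rewrite -/(a t) => E; rewrite -oppr0 -[in RHS]E; ring.
  apply: (wave_delta_shock (x'' := x'') (a' := a') (z' := x')) => //.
  + by move=> t /a_gt0/ltW.
  + by rewrite x0 !mulr0 subrr add0r.
  + by move=> t t0 h; rewrite /a'; ring.
  + move=> t t0 h; have [_ _ _ _] := H t t0; rewrite -/(a t) => E.
    have -> : a t * x'' t = - ((rho2 - rho1) * x' t ^+ 2
        - 2 * (rho2 * u2 - rho1 * u1) * x' t + (rho2 * u2 ^+ 2 - rho1 * u1 ^+ 2)).
      by apply/eqP; rewrite -addr_eq0 -[X in _ == X]E; apply/eqP; ring.
    by rewrite /a'; ring.
  + by rewrite gt_eqF.
  + by exists (`|u2| + `|u1|) => t /H[_ _ /norm_bound].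
  + by move=> y t _ xy; rewrite ltNge (ltW xy).
- move=> u01 u12.
  have u00 : u0 - 1 < u0 by rewrite ltrBlDr ltrDl.
  (* The curve of Case 1 with right density 0. The velocity u0 - 1 of this empty state is an
     arbitrary value below u0. *)
  have [x [x' [x'' [x0 x'0 H]]]] := @shock_curve_exists R m0 rho1 0 u0 u1 (u0 - 1)
    m0_gt0 rho1_ge0 (lexx 0) u00 u01.
  pose a t := - rho1 * x t + rho1 * u1 * t + m0.
  pose a' t := - rho1 * x' t + rho1 * u1.
  have dx1 (t : R) : 0 <= t -> is_derive t (1 : R) x (x' t) by move=> /H[[]].
  have dx2 (t : R) : 0 <= t -> is_derive t (1 : R) x' (x'' t) by move=> /H[[]].
  have aE t : (0 - rho1) * x t - (0 * (u0 - 1) - rho1 * u1) * t + m0 = a t.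
    by rewrite /a; ring.
  have a_gt0 (t : R) : 0 <= t -> 0 < a t by move=> /H[_]; rewrite aE.
  have ode (t : R) : 0 <= t ->
      a t * x'' t = rho1 * x' t ^+ 2 - 2 * (rho1 * u1) * x' t + rho1 * u1 ^+ 2.
    move=> /H[_ _ _ _]; rewrite aE => E; apply/eqP; rewrite -subr_eq0 -[X in _ == X]E.
    by apply/eqP; ring.
  have da (t : R) : 0 <= t -> is_derive t (1 : R) a (a' t).
    move=> t0; have dat := is_derive_fadd (is_derive_fadd
      (is_derive_fscale (- rho1) (dx1 t t0))
      (is_derive_fscale (rho1 * u1) (is_derive_fid t))) (is_derive_fcst m0 t).
    by apply: (is_derive_eq dat); rewrite mulr1 addr0.
  have dz (t : R) : 0 <= t -> is_derive t (1 : R) (fun t => u2 * t) u2.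
    move=> t0; have dzt := is_derive_fscale u2 (is_derive_fid t).
    by apply: (is_derive_eq dzt); rewrite mulr1.
  exists x, (fun t => radon_wave rho1 rho2 (a t) (x t) (u2 * t)); split.
    apply: (shock_ivpP dx1 dx2) => // t t0 d; have dE : d = - a t by rewrite /d /a; ring.
    rewrite dE oppr_eq0 gt_eqF ?a_gt0//; split => //.
    by rewrite mulNr ode//; ring.
  (* The contact line moves with the velocity of the right state, so its jump vanishes. *)
  apply: (wave_delta_shock (x'' := x'') (a' := a') (z := fun t => u2 * t)
    (z' := fun=> u2)) => //.
  + by move=> t /a_gt0/ltW.
  (* The shock stays behind the contact line: x t <= u1 t <= u2 t. *)
  + move=> t t0; have [_ _ _ xu _] := H t t0.
    by rewrite (le_trans xu)// ler_wpM2r.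
  + by move=> y t t0 xy zy; rewrite ltNge zy.
  + by rewrite x0 !mulr0 !add0r.
  + by rewrite mulr0.
  + by move=> t t0 h; rewrite /a'; ring.
  + by move=> t t0 h; rewrite ode// /a'; ring.
  + by rewrite gt_eqF.
  + by exists (`|u0 - 1| + `|u1|) => t /H[_ _ /norm_bound].
  + by move=> y t; case: ifP.
Qed.
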